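(* Let $0<\alpha<1$ and let $S_\alpha$ be the $\alpha$-stable random walk on $\mathbb{Z}$. Let $\mathcal{A}=\{a_n:n\in\mathbb{N}\}$ be a strictly increasing sequence of positive integers which is superlinear, i.e. $a_n\geq a_{n-k}+a_k$ for all $0<k<n$. Then the set $\mathcal{A}$ is $S_\alpha$-massive if and only if $$\sum_{n\geq 1}\frac{1}{a_n^{1-\alpha}}=\infty .$$
   Context: Let $S$ be the symmetric simple random walk on $\mathbb{Z}^d$, with transition operator $P$. For $0<\alpha<2$, the $\alpha$-stable random walk $S_\alpha$ is the random walk on $\mathbb{Z}^d$ with transition operator $P_\alpha=I-(I-P)^{\alpha/2}=\sum_{k\geq1}c_k P^k$, where $c_k=(-1)^{k+1}\binom{\alpha/2}{k}\geq 0$ and $\sum_k c_k=1$; equivalently $S_\alpha(n)=S(\tau_n)$ where $\tau$ is an independent random walk on $\mathbb{Z}^+$ (a discrete $\alpha/2$-stable subordinator) with $\mathbb{E}[s^{\tau_1}]=1-(1-s)^{\alpha/2}$. For $d=1$ and $0<\alpha<1$ the walk $S_\alpha$ is transient. A set $B\subset\mathbb{Z}^d$ is called $S_\alpha$-massive (recurrent) if for every starting point $x\in\mathbb{Z}^d$ the walk $S_\alpha$ started at $x$ hits $B$ with probability $1$, and non-massive otherwise. *)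

(* Defs.v *)
From Stdlib Require Import Reals ZArith ClassicalEpsilon.
From Coquelicot Require Import Coquelicot.
Open Scope R_scope.

(* k-step transition probability of the simple symmetric random walk on Z,
   as a function of the displacement z: q_0 = delta_0,
   q_{k+1}(z) = (q_k(z-1) + q_k(z+1))/2. *)
Fixpoint srw (k : nat) (z : Z) : R :=
  match k with
  | O => if Z.eq_dec z 0 then 1 else 0
  | S k' => (srw k' (z - 1)%Z + srw k' (z + 1)%Z) / 2
  end.

Fixpoint gbinom (a : R) (k : nat) : R :=
  match k with
  | O => 1
  | S k' => gbinom a k' * (a - INR k') / INR (S k')
  end.

Definition stable_coef (alpha : R) (k : nat) : R :=
  (-1) ^ (k + 1) * gbinom (alpha / 2) k.

(* one-step kernel of S_alpha: P_alpha(x, x+z) = sum_{k>=1} c_k P^k(0,z) *)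
Definition stable_kernel (alpha : R) (z : Z) : R :=
  Series (fun k => stable_coef alpha (S k) * srw (S k) z).

Definition sumZ (f : Z -> R) : R :=
  f 0%Z + Series (fun n => f (Z.of_nat (S n)) + f (- Z.of_nat (S n))%Z).

Fixpoint hit_within (alpha : R) (B : Z -> Prop) (n : nat) (x : Z) : R :=
  match n with
  | O => if excluded_middle_informative (B x) then 1 else 0
  | S n' => if excluded_middle_informative (B x) then 1
            else sumZ (fun y => stable_kernel alpha (y - x)%Z * hit_within alpha B n' y)
  end.

Definition massive (alpha : R) (B : Z -> Prop) : Prop :=
  forall x : Z, is_lim_seq (fun n => hit_within alpha B n x) 1.

(* Main.v *)
Require Import Defs.
From Stdlib Require Import Reals ZArith.
From Coquelicot Require Import Coquelicot.
From Stdlib Require Import Lra Lia ClassicalEpsilon.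
Open Scope R_scope.

(* With [b = alpha/2], [P_alpha = I - (I-P)^b] has Green function
   [G = (I-P)^(-b) = sum_j d_j P^j], where [d_j] are the coefficients of [(1-s)^(-b)].
   A hypergeometric telescoping gives [(n+1-b) G(n+1) = (n+b) G(n)], hence
   [G(n)] is comparable to [n^(alpha-1)].

   If [sum 1/a_n^(1-alpha)] converges, [v(x) = sum_n G(a_n - x)] is finite, superharmonic
   and at least 1 on the set, so it dominates the hitting probability, while [v < 1] far
   to the left.

   If the sum diverges, let [g_N] be the potential of the first points [a_n] and [S_N] its
   value at 0. Superlinearity gives [g_N <= G(0) + 2 S_N] on these points, so by the maximum
   principle the hitting probability is at least [g_N / (G(0) + 2 S_N)] everywhere. As
   [g_N(x) >= c S_N - O_x(1)], it is bounded below by a positive constant uniformly in [x],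
   and a zero-one argument makes it 1. *)

(** * Series with nonnegative terms *)

(** No probability space is built. Hitting is accessible only through [u], the increasing limit of
    [hit_within], which is superharmonic and equal to 1 on the set. Optional stopping thus becomes
    an induction on the number of steps, and comparison with a potential [g] becomes a maximum
    principle for [g - M u]. On the noncompact space Z the maximum is attained because [g] vanishes
    at infinity; this is why the divergent case uses potentials of finitely many points.

    The Green function is kept as a sum over time, so that (1-s)^b (1-s)^(-b) = 1 can be used on
    coefficients and every interchange of sums concerns nonnegative terms. Its terms are
    hypergeometric in time and space jointly, which is where the recurrence in space comes from. The
    condition alpha < 1, that is b < 1/2, enters here: d_j is of order j^(b-1) and the return
    probability of order j^(-1/2) at even times, so the sum at 0 converges and the boundary terms of
    the telescoping, of order j^(b-1/2), disappear.

    In the divergent case the number N of points depends on x, but the resulting bound on [u x] does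
    not; this uniformity is what the zero-one argument consumes. *)

Lemma sum_n_S (u : nat -> R) (n : nat) : sum_n u (S n) = sum_n u n + u (S n) :> R.
Proof. exact (sum_Sn u n). Qed.

Lemma sum_n_S_left (u : nat -> R) (n : nat) :
  sum_n u (S n) = u 0%nat + sum_n (fun k => u (S k)) n :> R.
Proof.
  induction n as [|n IH].
  - now rewrite sum_n_S, !sum_O.
  - rewrite (sum_n_S u), IH, sum_n_S. ring.
Qed.

Lemma sum_n_le (u v : nat -> R) (n : nat) :
  (forall k, (k <= n)%nat -> u k <= v k) -> sum_n u n <= sum_n v n.
Proof.
  induction n as [|n IH]; intros H.
  - rewrite !sum_O; auto.
  - rewrite !sum_n_S. apply Rplus_le_compat; auto.
Qed.

Lemma sum_n_eq (u v : nat -> R) (n : nat) :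
  (forall k, (k <= n)%nat -> u k = v k) -> sum_n u n = sum_n v n :> R.
Proof. exact (sum_n_ext_loc u v n). Qed.

Lemma sum_n_Rplus (u v : nat -> R) (n : nat) :
  sum_n (fun k => u k + v k) n = sum_n u n + sum_n v n :> R.
Proof. exact (sum_n_plus u v n). Qed.

Lemma sum_n_Rscal (c : R) (u : nat -> R) (n : nat) :
  sum_n (fun k => c * u k) n = c * sum_n u n :> R.
Proof. exact (sum_n_mult_l (K := R_Ring) c u n). Qed.

Lemma sum_n_nonneg (u : nat -> R) (n : nat) : (forall k, 0 <= u k) -> 0 <= sum_n u n.
Proof.
  intros H; induction n as [|n IH].
  - rewrite sum_O; auto.
  - rewrite sum_n_S; specialize (H (S n)); lra.
Qed.

Lemma term_le_sum_n (u : nat -> R) (k n : nat) :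
  (forall k, 0 <= u k) -> (k <= n)%nat -> u k <= sum_n u n.
Proof.
  intros H Hk; induction n as [|n IH].
  - replace k with 0%nat by lia. rewrite sum_O; lra.
  - rewrite sum_n_S. destruct (Nat.eq_dec k (S n)) as [->|Hne].
    + pose proof (sum_n_nonneg u n H); lra.
    + specialize (IH ltac:(lia)). specialize (H (S n)); lra.
Qed.

Lemma is_series_lim (u : nat -> R) (l : R) : is_series u l <-> is_lim_seq (sum_n u) l.
Proof. reflexivity. Qed.

Lemma sum_n_le_is_series (u : nat -> R) (l : R) (n : nat) :
  (forall k, 0 <= u k) -> is_series u l -> sum_n u n <= l.
Proof.
  intros H Hl. apply is_series_lim in Hl.
  apply (is_lim_seq_incr_compare (sum_n u)); auto.
  intros k; rewrite sum_n_S; specialize (H (S k)); lra.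
Qed.

Lemma is_series_nonneg (u : nat -> R) (l : R) :
  (forall k, 0 <= u k) -> is_series u l -> 0 <= l.
Proof.
  intros H Hl. apply Rle_trans with (1 := sum_n_nonneg u 0 H).
  now apply sum_n_le_is_series.
Qed.

Lemma term_le_is_series (u : nat -> R) (l : R) (k : nat) :
  (forall k, 0 <= u k) -> is_series u l -> u k <= l.
Proof.
  intros H Hl. apply Rle_trans with (1 := term_le_sum_n u k k H (le_n k)).
  now apply sum_n_le_is_series.
Qed.

Lemma is_series_le (u v : nat -> R) (lu lv : R) :
  (forall k, u k <= v k) -> is_series u lu -> is_series v lv -> lu <= lv.
Proof.
  intros H Hu Hv.
  apply (is_lim_seq_le (sum_n u) (sum_n v) lu lv); auto.
  intros n; apply sum_n_le; auto.
Qed.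

Lemma is_series_bounded (u : nat -> R) (M : R) :
  (forall k, 0 <= u k) -> (forall n, sum_n u n <= M) ->
  exists l, is_series u l /\ l <= M.
Proof.
  intros H HM.
  destruct (ex_finite_lim_seq_incr (sum_n u) M) as [l Hl]; auto.
  - intros k; rewrite sum_n_S; specialize (H (S k)); lra.
  - exists l; split; auto.
    apply (is_lim_seq_le (sum_n u) (fun _ => M) l M); auto. apply is_lim_seq_const.
Qed.

Lemma is_series_dominated (u v : nat -> R) (l : R) :
  (forall k, 0 <= u k <= v k) -> is_series v l -> exists m, is_series u m /\ m <= l.
Proof.
  intros H Hv. apply is_series_bounded; [intros k; apply H|].
  intros n. apply Rle_trans with (sum_n v n).
  - apply sum_n_le; intros; apply H.
  - apply sum_n_le_is_series; auto. intros k; specialize (H k); lra.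
Qed.

Lemma is_series_Rplus (u v : nat -> R) (l m : R) :
  is_series u l -> is_series v m -> is_series (fun n => u n + v n) (l + m).
Proof. exact (is_series_plus u v l m). Qed.

Lemma is_series_Rscal (c : R) (u : nat -> R) (l : R) :
  is_series u l -> is_series (fun n => c * u n) (c * l).
Proof. exact (is_series_scal c u l). Qed.

Lemma is_series_eq (u v : nat -> R) (l m : R) :
  is_series u l -> (forall n, u n = v n) -> l = m -> is_series v m.
Proof. intros H E <-. now apply is_series_ext with u. Qed.

Lemma is_series_sum_n (f : nat -> nat -> R) (t : nat -> R) (n : nat) :
  (forall j, is_series (fun i => f i j) (t j)) ->
  is_series (fun i => sum_n (f i) n) (sum_n t n).
Proof.
  intros H; induction n as [|n IH].
  - apply (is_series_eq _ _ _ _ (H 0%nat)); intros; now rewrite sum_O.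
  - apply (is_series_eq _ _ _ _ (is_series_Rplus _ _ _ _ IH (H (S n))));
      intros; now rewrite sum_n_S.
Qed.

(** The first n columns form a finite sum of series, which may be exchanged with the row sums and so
    stays below [l]; boundedness then gives convergence. Applied to [f] and to its transpose, the
    inequality becomes the equality of [series_tonelli]. *)
Lemma series_swap_le (f : nat -> nat -> R) (s : nat -> R) (l : R) :
  (forall i j, 0 <= f i j) -> (forall i, is_series (f i) (s i)) -> is_series s l ->
  exists t m, (forall j, is_series (fun i => f i j) (t j)) /\ is_series t m /\ m <= l.
Proof.
  intros Hf Hr Hs.
  assert (Hc : forall j, ex_series (fun i => f i j)).
  { intros j. destruct (is_series_dominated (fun i => f i j) s l) as [m [Hm _]]; auto.
    - intros i; split; auto. now apply (term_le_is_series (f i)).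
    - now exists m. }
  exists (fun j => Series (fun i => f i j)).
  destruct (is_series_bounded (fun j => Series (fun i => f i j)) l) as [m Hm].
  - intros j. apply (is_series_nonneg (fun i => f i j)); auto. now apply Series_correct.
  - intros n. apply (is_series_le (fun i => sum_n (f i) n) s); auto.
    + intros i. now apply sum_n_le_is_series.
    + apply (is_series_sum_n f). intros j; now apply Series_correct.
  - exists m; intuition. now apply Series_correct.
Qed.

Lemma series_tonelli (f : nat -> nat -> R) (s : nat -> R) (l : R) :
  (forall i j, 0 <= f i j) -> (forall i, is_series (f i) (s i)) -> is_series s l ->
  exists t, (forall j, is_series (fun i => f i j) (t j)) /\ is_series t l.
Proof.
  intros Hf Hr Hs.
  destruct (series_swap_le f s l Hf Hr Hs) as (t & m & Ht & Hm & Hml).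
  destruct (series_swap_le (fun i j => f j i) t m (fun i j => Hf j i) Ht Hm)
    as (s' & l' & Hs' & Hl' & Hlm).
  assert (l' = l).
  { rewrite <- (is_series_unique s' l' Hl'), <- (is_series_unique s l Hs).
    apply Series_ext; intros i.
    rewrite <- (is_series_unique _ _ (Hs' i)).
    exact (is_series_unique (f i) _ (Hr i)). }
  exists t; split; auto. replace l with m by lra. exact Hm.
Qed.

Lemma series_tonelli_columns (f : nat -> nat -> R) (s t : nat -> R) (l : R) :
  (forall i j, 0 <= f i j) -> (forall i, is_series (f i) (s i)) ->
  (forall j, is_series (fun i => f i j) (t j)) -> is_series s l -> is_series t l.
Proof.
  intros Hf Hr Hc Hs.
  destruct (series_tonelli f s l Hf Hr Hs) as (t' & Ht' & Hl).
  apply (is_series_eq _ _ _ _ Hl); auto.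
  intros j. rewrite <- (is_series_unique _ _ (Ht' j)). apply is_series_unique, Hc.
Qed.

Lemma is_series_incr (u : nat -> R) (l : R) :
  is_series u l -> is_series (fun k => u (S k)) (l - u 0%nat).
Proof.
  intros H. apply (is_series_incr_1 u). unfold plus; simpl.
  apply (is_series_eq _ _ _ _ H); auto; ring.
Qed.

Lemma is_series_decr (u : nat -> R) (l : R) :
  is_series (fun k => u (S k)) l -> is_series u (u 0%nat + l).
Proof.
  intros H. apply (is_series_decr_1 u). unfold plus, opp; simpl.
  apply (is_series_eq _ _ _ _ H); auto; ring.
Qed.

Lemma is_series_zero : is_series (fun _ : nat => 0) 0.
Proof.
  apply is_series_lim. apply is_lim_seq_ext with (fun _ => 0); [|apply is_lim_seq_const].
  intros n; induction n as [|n IH]; [now rewrite sum_O|].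
  rewrite sum_n_S, <- IH; ring.
Qed.

Lemma is_series_finite (u : nat -> R) (N : nat) :
  (forall k, (N < k)%nat -> u k = 0) -> is_series u (sum_n u N).
Proof.
  revert u; induction N as [|N IH]; intros u H.
  - rewrite sum_O.
    apply (is_series_eq u u (u 0%nat + 0)); auto; [|ring].
    apply is_series_decr.
    apply (is_series_eq _ _ _ _ is_series_zero); auto.
    intros k; symmetry; apply H; lia.
  - apply is_series_eq with u (u 0%nat + sum_n (fun k => u (S k)) N); auto.
    + apply is_series_decr, IH. intros k Hk; apply H; lia.
    + symmetry; apply sum_n_S_left.
Qed.

Lemma is_series_shift (u : nat -> R) (n : nat) (l : R) :
  (forall k, (k < n)%nat -> u k = 0) -> is_series (fun k => u (n + k)%nat) l ->
  is_series u l.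
Proof.
  revert u; induction n as [|n IH]; intros u H Hl; [exact Hl|].
  apply is_series_eq with u (u 0%nat + l); auto.
  - apply is_series_decr, IH; auto. intros k Hk; apply H; lia.
  - rewrite H by lia; ring.
Qed.

(** * Sums over the integers *)

(* Folding [Z] along [z <-> -z] turns [sumZ] into an ordinary series. *)
Definition foldZ (f : Z -> R) (n : nat) : R :=
  match n with
  | O => f 0%Z
  | S _ => f (Z.of_nat n) + f (- Z.of_nat n)%Z
  end.

(** A relation that includes convergence: [sumZ] is total through [Series], so an equation about its
    value would say nothing on summability. *)
Definition is_sumZ (f : Z -> R) (l : R) : Prop := is_series (foldZ f) l.

Lemma is_sumZ_unique (f : Z -> R) (l : R) : is_sumZ f l -> sumZ f = l.
Proof.
  intros H. unfold sumZ.
  rewrite (is_series_unique _ (l - f 0%Z)); [ring|].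
  exact (is_series_incr _ _ H).
Qed.

Lemma foldZ_le (f g : Z -> R) (n : nat) : (forall z, f z <= g z) -> foldZ f n <= foldZ g n.
Proof. intros H; destruct n; simpl; auto. apply Rplus_le_compat; apply H. Qed.

Lemma foldZ_nonneg (f : Z -> R) (n : nat) : (forall z, 0 <= f z) -> 0 <= foldZ f n.
Proof. intros H; destruct n; simpl; auto. apply Rplus_le_le_0_compat; apply H. Qed.

Lemma foldZ_ext (f g : Z -> R) (n : nat) : (forall z, f z = g z) -> foldZ f n = foldZ g n.
Proof. intros H; destruct n; simpl; rewrite ?H; auto. Qed.

Lemma foldZ_plus (f g : Z -> R) (n : nat) :
  foldZ (fun z => f z + g z) n = foldZ f n + foldZ g n.
Proof. destruct n; simpl; ring. Qed.

Lemma foldZ_scal (c : R) (f : Z -> R) (n : nat) : foldZ (fun z => c * f z) n = c * foldZ f n.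
Proof. destruct n; simpl; ring. Qed.

Lemma is_sumZ_eq (f g : Z -> R) (l m : R) :
  is_sumZ f l -> (forall z, f z = g z) -> l = m -> is_sumZ g m.
Proof.
  intros H E <-. apply (is_series_eq _ _ _ _ H); auto. intros n; now apply foldZ_ext.
Qed.

Lemma is_sumZ_plus (f g : Z -> R) (l m : R) :
  is_sumZ f l -> is_sumZ g m -> is_sumZ (fun z => f z + g z) (l + m).
Proof.
  intros Hf Hg. apply (is_series_eq _ _ _ _ (is_series_Rplus _ _ _ _ Hf Hg)); auto.
  intros n; symmetry; apply foldZ_plus.
Qed.

Lemma is_sumZ_scal (c : R) (f : Z -> R) (l : R) :
  is_sumZ f l -> is_sumZ (fun z => c * f z) (c * l).
Proof.
  intros Hf. apply (is_series_eq _ _ _ _ (is_series_Rscal c _ _ Hf)); auto.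
  intros n; symmetry; apply foldZ_scal.
Qed.

Lemma is_sumZ_le (f g : Z -> R) (l m : R) :
  (forall z, f z <= g z) -> is_sumZ f l -> is_sumZ g m -> l <= m.
Proof. intros H. apply is_series_le. intros n; now apply foldZ_le. Qed.

Lemma is_sumZ_dominated (f g : Z -> R) (l : R) :
  (forall z, 0 <= f z <= g z) -> is_sumZ g l -> exists m, is_sumZ f m /\ m <= l.
Proof.
  intros H. apply is_series_dominated. intros n; split.
  - apply foldZ_nonneg; intros z; apply H.
  - apply foldZ_le; intros z; apply H.
Qed.

Lemma foldZ_term_le (f : Z -> R) (z : Z) :
  (forall z, 0 <= f z) -> f z <= foldZ f (Z.abs_nat z).
Proof.
  intros H. destruct (Z.abs_nat z) as [|n] eqn:E.
  - replace z with 0%Z by lia. apply Rle_refl.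
  - unfold foldZ. rewrite <- E.
    pose proof (H (Z.of_nat (Z.abs_nat z))). pose proof (H (- Z.of_nat (Z.abs_nat z))%Z).
    destruct (Z.le_ge_cases 0 z) as [Hz|Hz].
    + replace (Z.of_nat (Z.abs_nat z)) with z in * by lia. lra.
    + replace (- Z.of_nat (Z.abs_nat z))%Z with z in * by lia. lra.
Qed.

Lemma is_sumZ_term_le (f : Z -> R) (l : R) (z : Z) :
  (forall z, 0 <= f z) -> is_sumZ f l -> f z <= l.
Proof.
  intros H Hl. apply Rle_trans with (1 := foldZ_term_le f z H).
  apply (term_le_is_series (foldZ f)); auto. intros n; now apply foldZ_nonneg.
Qed.

Lemma is_sumZ_tonelli (f : nat -> Z -> R) (s : nat -> R) (g : Z -> R) (l : R) :
  (forall i z, 0 <= f i z) -> (forall i, is_sumZ (f i) (s i)) ->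
  (forall z, is_series (fun i => f i z) (g z)) -> is_series s l -> is_sumZ g l.
Proof.
  intros Hf Hr Hc. apply (series_tonelli_columns (fun i => foldZ (f i))); auto.
  - intros i n; now apply foldZ_nonneg.
  - intros [|n]; simpl; auto. now apply is_series_Rplus.
Qed.

(** * Coefficients of powers of [1-z] *)

(* [coef t n] is the coefficient of [z^n] in [(1-z)^(t-1)]. *)
Fixpoint coef (t : R) (n : nat) : R :=
  match n with
  | O => 1
  | S m => coef t m * (1 - t / INR (S m))
  end.

Lemma coef_S (t : R) (n : nat) : coef t (S n) = coef t n * (1 - t / INR (S n)).
Proof. reflexivity. Qed.

Lemma coef_succ (t : R) (n : nat) : INR (S n) * coef t (S n) = coef t n * (INR (S n) - t).
Proof. rewrite !coef_S. field. apply not_0_INR; lia. Qed.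

Lemma INR_S_pos (n : nat) : 0 < INR (S n).
Proof. apply lt_0_INR; lia. Qed.

Lemma coef_pos (t : R) (n : nat) : t < 1 -> 0 < coef t n.
Proof.
  intros Ht; induction n as [|n IH]; [simpl; lra|].
  apply Rmult_lt_reg_l with (1 := INR_S_pos n). rewrite coef_succ, Rmult_0_r.
  apply Rmult_lt_0_compat; auto. rewrite S_INR; pose proof (pos_INR n); lra.
Qed.

Lemma gbinom_coef (a : R) (k : nat) : (-1) ^ k * gbinom a k = coef (1 + a) k.
Proof.
  induction k as [|k IH]; [simpl; ring|].
  rewrite !coef_S. rewrite <- IH. change (gbinom a (S k)) with (gbinom a k * (a - INR k) / INR (S k)).
  rewrite <- tech_pow_Rmult, S_INR. pose proof (pos_INR k). field; lra.
Qed.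

Lemma stable_coef_coef (alpha : R) (k : nat) :
  stable_coef alpha k = - coef (1 + alpha / 2) k.
Proof. unfold stable_coef. rewrite <- gbinom_coef, pow_add. simpl; ring. Qed.

(** The derivative of (1-z)^b is -b (1-z)^(b-1), read on coefficients. The right-hand side shows the
    sign of the coefficients c_k. *)
Lemma coef_1p_succ (b : R) (n : nat) : - coef (1 + b) (S n) = coef b n * b / INR (S n).
Proof.
  induction n as [|n IH]; [simpl; field|].
  replace (- coef (1 + b) (S (S n)))
    with (- coef (1 + b) (S n) * (1 - (1 + b) / INR (S (S n)))) by (rewrite (coef_S _ (S n)); ring).
  rewrite IH. rewrite !coef_S. rewrite !S_INR. pose proof (pos_INR n). field; lra.
Qed.

Lemma stable_coef_pos (alpha : R) (k : nat) : 0 < alpha < 1 -> 0 < stable_coef alpha (S k).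
Proof.
  intros H. rewrite stable_coef_coef, coef_1p_succ.
  apply Rdiv_lt_0_compat; [|apply INR_S_pos].
  apply Rmult_lt_0_compat; [apply coef_pos|]; lra.
Qed.

(** Dividing (1-z)^b by 1-z replaces coefficients by partial sums and yields (1-z)^(b-1). The total
    mass of the c_k is therefore 1 as soon as [coef (alpha / 2)] tends to 0. *)
Lemma sum_stable_coef (alpha : R) (n : nat) :
  sum_n (fun k => stable_coef alpha (S k)) n = 1 - coef (alpha / 2) (S n) :> R.
Proof.
  induction n as [|n IH].
  - rewrite sum_O, stable_coef_coef. simpl; field.
  - rewrite sum_n_S, IH, stable_coef_coef, coef_1p_succ.
    rewrite !coef_S. rewrite !S_INR. pose proof (pos_INR n). field; lra.
Qed.

(* When [s + t = 2] the generating functions [(1-z)^(s-1)] and [(1-z)^(t-1)] have product 1;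
   on coefficients, differentiating the product reads [(n+1) e_{n+1} = n e_n]. *)
Lemma coef_convolution (s t : R) (n : nat) : s + t = 2 ->
  sum_n (fun i => coef s i * coef t (S n - i)) (S n) = 0 :> R.
Proof.
  intros Hst.
  set (e := fun n : nat => sum_n (fun i => coef s i * coef t (n - i)) n : R).
  assert (Hrec : forall n, INR (S n) * e (S n) = INR n * e n).
  { intros m. unfold e.
    transitivity (sum_n (fun i => INR i * coef s i * coef t (S m - i)) (S m)
                + sum_n (fun i => coef s i * (INR (S m - i) * coef t (S m - i))) (S m)).
    - rewrite <- sum_n_Rplus.
      rewrite <- sum_n_Rscal. apply sum_n_eq.
      intros k Hk.
      rewrite (minus_INR (S m) k) by lia. ring.
    - rewrite (sum_n_S_left (fun i => INR i * coef s i * coef t (S m - i))).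
      rewrite (sum_n_S (fun i => coef s i * (INR (S m - i) * coef t (S m - i)))).
      rewrite Nat.sub_diag. simpl (INR 0).
      rewrite !Rmult_0_l, Rmult_0_r, Rplus_0_l, Rplus_0_r.
      rewrite <- sum_n_Rplus.
      rewrite <- sum_n_Rscal. apply sum_n_eq.
      intros k Hk.
      rewrite coef_succ. replace (S m - S k)%nat with (m - k)%nat by lia.
      replace (S m - k)%nat with (S (m - k)) by lia. rewrite coef_succ.
      replace (INR m) with (INR (k + (m - k))) by (f_equal; lia).
      rewrite plus_INR, !S_INR. replace t with (2 - s) by lra. ring. }
  assert (H0 : forall n, INR n * e n = 0).
  { intros m; induction m as [|m IH]; [simpl; ring|]. now rewrite Hrec. }
  apply Rmult_eq_reg_l with (INR (S n)); [|apply not_0_INR; lia].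
  rewrite Rmult_0_r. apply (H0 (S n)).
Qed.

(** * Comparison of the coefficients with powers *)

Lemma Rpower_bernoulli (th t : R) : 0 <= th <= 1 -> -1 < t -> Rpower (1 + t) th <= 1 + th * t.
Proof.
  intros Hth Ht.
  assert (Hs : 0 < 1 + th * t) by (destruct (Rle_lt_dec 0 t); nra).
  assert (Hln : forall x, 0 < x -> ln x <= x - 1).
  { intros x Hx. pose proof (exp_ineq1_le (ln x)). rewrite exp_ln in H; lra. }
  (* concavity of [ln]: both [1+t] and [1] lie under the tangent at [1+th*t] *)
  pose proof (Hln ((1 + t) / (1 + th * t)) ltac:(apply Rdiv_lt_0_compat; lra)) as H1.
  pose proof (Hln (1 / (1 + th * t)) ltac:(apply Rdiv_lt_0_compat; lra)) as H2.
  rewrite ln_div in H1, H2 by lra. rewrite ln_1 in H2.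
  unfold Rpower. rewrite <- (exp_ln (1 + th * t)) by exact Hs.
  match goal with |- exp ?x <= exp ?y => cut (x <= y) end.
  { intros [Hlt| ->]; [left; now apply exp_increasing|apply Rle_refl]. }
  assert (th * ((1 + t) / (1 + th * t) - 1) + (1 - th) * (1 / (1 + th * t) - 1) = 0)
    by (field; lra).
  nra.
Qed.

Lemma Rpower_pos (x y : R) : 0 < Rpower x y.
Proof. apply exp_pos. Qed.

(** The left side is nonincreasing in n: with x = 1/(n+1), one step multiplies it by (1 - t x)(1 +
    x)^t, which is at most (1 - t x)(1 + t x) <= 1. *)
Lemma coef_Rpower_le (t : R) (n : nat) : 0 <= t < 1 -> coef t n * Rpower (INR (S n)) t <= 1.
Proof.
  intros Ht. induction n as [|n IH].
  - simpl. unfold Rpower. rewrite ln_1, Rmult_0_r, exp_0. lra.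
  - pose proof (INR_S_pos n) as Hn.
    assert (E : INR (S (S n)) = INR (S n) * (1 + / INR (S n))).
    { rewrite (S_INR (S n)). field. lra. }
    pose proof (Rinv_0_lt_compat _ Hn) as Hi.
    rewrite E, <- Rpower_mult_distr by lra. rewrite !coef_S.
    pose proof (Rpower_bernoulli t (/ INR (S n)) ltac:(lra) ltac:(lra)) as HB.
    pose proof (coef_pos t n ltac:(lra)) as Hc.
    pose proof (Rpower_pos (INR (S n)) t) as Hp.
    pose proof (Rpower_pos (1 + / INR (S n)) t) as Hq.
    unfold Rdiv. set (x := / INR (S n)) in *.
    assert (Hx : x <= 1).
    { unfold x. rewrite <- Rinv_1. apply Rinv_le_contravar; [lra|].
      rewrite S_INR; pose proof (pos_INR n); lra. }
    assert (Hk : (1 - t * x) * Rpower (1 + x) t <= 1).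
    { apply Rle_trans with ((1 - t * x) * (1 + t * x)).
      - apply Rmult_le_compat_l; nra.
      - nra. }
    assert (0 <= (1 - t * x) * Rpower (1 + x) t) by (apply Rmult_le_pos; nra).
    apply Rle_trans with ((coef t n * Rpower (INR (S n)) t) * ((1 - t * x) * Rpower (1 + x) t)).
    + right; ring.
    + apply Rle_trans with (1 * ((1 - t * x) * Rpower (1 + x) t)); [|lra].
      apply Rmult_le_compat_r; lra.
Qed.

Lemma Rpower_neg_lim (t : R) : 0 < t -> is_lim_seq (fun n => Rpower (INR (S n)) (- t)) 0.
Proof.
  intros Ht. apply is_lim_seq_spec. intros eps.
  destruct (INR_unbounded (Rpower eps (- / t))) as [N HN].
  exists N. intros n Hn. rewrite Rminus_0_r, Rabs_pos_eq by (left; apply Rpower_pos).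
  apply le_INR in Hn.
  assert (Hlt : Rpower eps (- / t) < INR (S n)) by (rewrite S_INR; lra).
  replace (pos eps) with (Rpower (Rpower eps (- / t)) (- t)).
  - unfold Rpower at 1 2. apply exp_increasing.
    apply ln_increasing in Hlt; [|apply Rpower_pos]. nra.
  - rewrite Rpower_mult. replace (- / t * - t) with 1 by (field; lra).
    apply Rpower_1, cond_pos.
Qed.

Lemma coef_le_Rpower (t : R) (n : nat) : 0 <= t < 1 -> coef t n <= Rpower (INR (S n)) (- t).
Proof.
  intros Ht. pose proof (coef_Rpower_le t n Ht) as H.
  rewrite Rpower_Ropp. apply Rmult_le_reg_r with (Rpower (INR (S n)) t); [apply Rpower_pos|].
  rewrite Rinv_l; auto. apply Rgt_not_eq, Rpower_pos.
Qed.

Lemma coef_lim (t : R) : 0 < t < 1 -> is_lim_seq (coef t) 0.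
Proof.
  intros Ht.
  apply is_lim_seq_le_le with (fun _ => 0) (fun n => Rpower (INR (S n)) (- t)).
  - intros n; split; [left; apply coef_pos; lra|apply coef_le_Rpower; lra].
  - apply is_lim_seq_const.
  - apply Rpower_neg_lim; lra.
Qed.

Lemma is_series_stable_coef (alpha : R) : 0 < alpha < 1 ->
  is_series (fun k => stable_coef alpha (S k)) 1.
Proof.
  intros H. apply is_series_lim.
  apply is_lim_seq_ext with (fun n => 1 - coef (alpha / 2) (S n)).
  - intros n; now rewrite sum_stable_coef.
  - replace (Finite 1) with (Finite (1 - 0)) by (f_equal; ring).
    apply is_lim_seq_minus'; [apply is_lim_seq_const|].
    apply (is_lim_seq_incr_1 (coef (alpha / 2))), coef_lim; lra.
Qed.

(** * The simple random walk *)

Lemma srw_nonneg (k : nat) (z : Z) : 0 <= srw k z.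
Proof.
  revert z; induction k as [|k IH]; intros z; simpl.
  - destruct (Z.eq_dec z 0); lra.
  - pose proof (IH (z - 1)%Z). pose proof (IH (z + 1)%Z). lra.
Qed.

Lemma srw_le_1 (k : nat) (z : Z) : srw k z <= 1.
Proof.
  revert z; induction k as [|k IH]; intros z; simpl.
  - destruct (Z.eq_dec z 0); lra.
  - pose proof (IH (z - 1)%Z). pose proof (IH (z + 1)%Z). lra.
Qed.

Lemma srw_opp (k : nat) (z : Z) : srw k (- z) = srw k z.
Proof.
  revert z; induction k as [|k IH]; intros z; simpl.
  - destruct (Z.eq_dec z 0), (Z.eq_dec (- z) 0); auto; lia.
  - rewrite <- (IH (z - 1)%Z), <- (IH (z + 1)%Z).
    replace (- (z - 1))%Z with (- z + 1)%Z by lia.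
    replace (- (z + 1))%Z with (- z - 1)%Z by lia. field.
Qed.

Lemma srw_far (k : nat) (z : Z) : (Z.of_nat k < Z.abs z)%Z -> srw k z = 0.
Proof.
  revert z; induction k as [|k IH]; intros z Hz; simpl.
  - destruct (Z.eq_dec z 0); auto; lia.
  - rewrite !IH by lia. field.
Qed.

Lemma srw_S (k : nat) (z : Z) : srw (S k) z = (srw k (z - 1) + srw k (z + 1)) / 2.
Proof. reflexivity. Qed.

(** Coefficient form of applying w d/dw to the generating function ((w + 1/w)/2)^(k+1). Combined
    with the defining recurrence it gives [srw_up] and [srw_down], which take the place of the
    binomial formula and its parity cases. *)
Lemma srw_diff (k : nat) (z : Z) :
  IZR z * srw (S k) z = INR (S k) * (srw k (z - 1) - srw k (z + 1)) / 2.
Proof.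
  revert z; induction k as [|k IH]; intros z.
  - simpl. destruct (Z.eq_dec (z - 1) 0), (Z.eq_dec (z + 1) 0); try lia.
    + replace z with 1%Z by lia. lra.
    + replace z with (-1)%Z by lia. lra.
    + lra.
  - rewrite (srw_S (S k) z).
    pose proof (IH (z - 1)%Z) as H1. pose proof (IH (z + 1)%Z) as H2.
    rewrite minus_IZR in H1. rewrite plus_IZR in H2.
    rewrite (S_INR (S k)).
    replace (z - 1 + 1)%Z with z in * by lia. replace (z + 1 - 1)%Z with z in * by lia.
    assert (H3 : srw (S k) (z - 1) - srw (S k) (z + 1)
               = (srw k (z - 1 - 1) - srw k (z + 1 + 1)) / 2).
    { rewrite !srw_S. replace (z - 1 + 1)%Z with z by lia.
      replace (z + 1 - 1)%Z with z by lia. field. }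
    nra.
Qed.

Lemma srw_up (k : nat) (z : Z) :
  (INR (S k) + IZR z) * srw (S k) z = INR (S k) * srw k (z - 1).
Proof. pose proof (srw_diff k z). rewrite srw_S in *. lra. Qed.

Lemma srw_down (k : nat) (z : Z) :
  (INR (S k) - IZR z) * srw (S k) z = INR (S k) * srw k (z + 1).
Proof. pose proof (srw_diff k z). rewrite srw_S in *. lra. Qed.

Lemma srw_two_steps (k : nat) (z : Z) :
  (INR (S (S k)) + IZR z) * (INR (S (S k)) - IZR z) * srw (S (S k)) z
  = INR (S (S k)) * INR (S k) * srw k z.
Proof.
  pose proof (srw_up (S k) z) as H1. pose proof (srw_down k (z - 1)) as H2.
  rewrite minus_IZR in H2. replace (z - 1 + 1)%Z with z in H2 by lia.
  rewrite (S_INR (S k)) in *.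
  transitivity ((INR (S k) + 1 - IZR z) * ((INR (S k) + 1) * srw (S k) (z - 1))).
  - rewrite <- H1; ring.
  - replace ((INR (S k) + 1) * INR (S k) * srw k z)
      with ((INR (S k) + 1) * (INR (S k) * srw k z)) by ring.
    rewrite <- H2; ring.
Qed.

(** Parity forces an induction by two steps. With n = k+1, the return probability is multiplied by
    n/(n+1) over two steps, and the bound survives because n(n+2) <= (n+1)^2. *)
Lemma srw_return_sq (k : nat) : (srw k 0)² * INR (S k) <= 1.
Proof.
  assert (H : (srw k 0)² * INR (S k) <= 1 /\ (srw (S k) 0)² * INR (S (S k)) <= 1); [|apply H].
  induction k as [|k [IH1 IH2]].
  - unfold Rsqr; simpl; lra.
  - split; auto. pose proof (srw_two_steps k 0) as E.
    pose proof (INR_S_pos k) as Hk. rewrite !(S_INR (S (S k))), !(S_INR (S k)) in *.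
    set (n := INR (S k)) in *. set (p := srw k 0) in *. set (q := srw (S (S k)) 0) in *.
    assert (Eq : q = n / (n + 1) * p).
    { apply Rmult_eq_reg_l with ((n + 1) * (n + 1)); [|nra].
      replace ((n + 1) * (n + 1) * q) with ((n + 1 + 0) * (n + 1 - 0) * q) by ring.
      rewrite E. field. lra. }
    rewrite Eq. unfold Rsqr in *.
    apply Rle_trans with (2 := IH1).
    replace (n / (n + 1) * p * (n / (n + 1) * p) * (n + 1 + 1))
      with (p * p * n * (n * (n + 2) / ((n + 1) * (n + 1)))) by (field; lra).
    rewrite <- (Rmult_1_r (p * p * n)) at 2.
    apply Rmult_le_compat_l; [nra|].
    apply Rmult_le_reg_r with ((n + 1) * (n + 1)); [nra|].
    unfold Rdiv. rewrite Rmult_assoc, Rinv_l by nra. nra.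
Qed.

Lemma srw_return_le (k : nat) : srw k 0 <= Rpower (INR (S k)) (- / 2).
Proof.
  pose proof (srw_return_sq k) as H. pose proof (INR_S_pos k) as Hk.
  apply Rsqr_incr_0_var; [|left; apply Rpower_pos].
  replace (Rsqr (Rpower (INR (S k)) (- / 2))) with (/ INR (S k)).
  - apply Rmult_le_reg_r with (1 := Hk). rewrite Rinv_l; lra.
  - unfold Rsqr. rewrite <- Rpower_plus.
    replace (- / 2 + - / 2) with (- (1)) by field.
    rewrite Rpower_Ropp, Rpower_1; auto.
Qed.

(** * The Green function *)

Definition green_term (b : R) (z : Z) (j : nat) : R := coef (1 - b) j * srw j z.

Definition green (b : R) (z : Z) : R := Series (green_term b z).

Lemma green_term_nonneg (b : R) (z : Z) (j : nat) : 0 < b -> 0 <= green_term b z j.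
Proof.
  intros Hb. apply Rmult_le_pos; [left; apply coef_pos; lra|apply srw_nonneg].
Qed.

(** Moving one step in space together with one step in time preserves the parity of j - n, so the
    quotient of the two terms is a rational function of j and n. *)
Lemma green_term_up (b : R) (n j : nat) :
  green_term b (Z.of_nat (S n)) (S j)
  = green_term b (Z.of_nat n) j * ((INR j + b) / (INR j + INR n + 2)).
Proof.
  pose proof (pos_INR j) as Hj. pose proof (pos_INR n) as Hn.
  pose proof (coef_succ (1 - b) j) as Hd. pose proof (srw_up j (Z.of_nat (S n))) as Hp.
  replace (Z.of_nat (S n) - 1)%Z with (Z.of_nat n) in Hp by lia.
  rewrite <- INR_IZR_INZ, !S_INR in Hp. rewrite S_INR in Hd.
  unfold green_term.
  apply Rmult_eq_reg_l with ((INR j + 1) * (INR j + 1 + (INR n + 1))); [|nra].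
  transitivity ((INR j + 1) * coef (1 - b) (S j)
    * ((INR j + 1 + (INR n + 1)) * srw (S j) (Z.of_nat (S n)))); [ring|].
  rewrite Hd, Hp. field. lra.
Qed.

(** The factor j + 2 - n stays on the left because it vanishes when j + 2 = n, the first time the
    walk can reach n: there the term at j is 0 while the probability at j + 2 is not. *)
Lemma green_term_down (b : R) (n j : nat) :
  (INR j + 2 - INR n) * green_term b (Z.of_nat n) (S (S j))
  = green_term b (Z.of_nat n) j * ((INR j + b) * (INR j + 1 + b) / (INR j + INR n + 2)).
Proof.
  pose proof (pos_INR j) as Hj. pose proof (pos_INR n) as Hn.
  pose proof (coef_succ (1 - b) j) as Hd. pose proof (coef_succ (1 - b) (S j)) as Hd2.
  pose proof (srw_two_steps j (Z.of_nat n)) as Hp.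
  rewrite <- INR_IZR_INZ in Hp. rewrite !S_INR in *.
  unfold green_term.
  set (d2 := coef (1 - b) (S (S j))) in *. set (p2 := srw (S (S j)) (Z.of_nat n)) in *.
  apply Rmult_eq_reg_l with
    ((INR j + 1) * (INR j + 1 + 1) * (INR j + 1 + 1 + INR n)); [|nra].
  transitivity ((INR j + 1) * ((INR j + 1 + 1) * d2)
    * ((INR j + 1 + 1 + INR n) * (INR j + 1 + 1 - INR n) * p2)); [ring|].
  rewrite Hd2, Hp.
  transitivity (((INR j + 1) * coef (1 - b) (S j)) * (INR j + 1 + 1 - (1 - b))
    * ((INR j + 1 + 1) * (INR j + 1) * srw j (Z.of_nat n))); [ring|].
  rewrite Hd. field. lra.
Qed.

(* Zeilberger's certificate for the hypergeometric sum [green b]. *)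
Lemma green_term_telescope (b : R) (n j : nat) :
  (INR n + 1 - b) * green_term b (Z.of_nat (S n)) (S j)
    - (INR n + b) * green_term b (Z.of_nat n) j
  = (INR j - INR n) * green_term b (Z.of_nat n) j
    - (INR (S (S j)) - INR n) * green_term b (Z.of_nat n) (S (S j)).
Proof.
  pose proof (pos_INR j) as Hj. pose proof (pos_INR n) as Hn.
  rewrite !S_INR. replace (INR j + 1 + 1 - INR n) with (INR j + 2 - INR n) by ring.
  rewrite green_term_down, green_term_up. field. lra.
Qed.

Lemma green_term_up_le (b : R) (n j : nat) : 0 < b < / 2 ->
  green_term b (Z.of_nat (S n)) (S j) <= green_term b (Z.of_nat n) j.
Proof.
  intros Hb. pose proof (pos_INR j) as Hj. pose proof (pos_INR n) as Hn.
  rewrite green_term_up. rewrite <- Rmult_1_r.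
  apply Rmult_le_compat_l; [apply green_term_nonneg; lra|].
  apply Rmult_le_reg_r with (INR j + INR n + 2); [lra|].
  unfold Rdiv. rewrite Rmult_assoc, Rinv_l by lra. lra.
Qed.

(** A Kummer-type test whose weights come from [green_term_telescope] at n = 0: the decrement of [T]
    at j is [a j] times a factor tending to 1 - 2b > 0. Half of this limit is [eps], and the factor
    exceeds it once j eps >= 2, so the tail sums are at most [T J / eps]. *)
Lemma green_term_0_summable (b : R) : 0 < b < / 2 -> ex_series (green_term b 0).
Proof.
  intros Hb. set (a := green_term b 0).
  assert (Ha : forall j, 0 <= a j) by (intros; apply green_term_nonneg; lra).
  set (eps := (1 - 2 * b) / 2). assert (Heps : 0 < eps) by (unfold eps; lra).
  destruct (INR_unbounded (2 / eps)) as [J HJ].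
  assert (HJ2 : 2 < INR J * eps).
  { apply Rmult_lt_reg_r with (/ eps); [now apply Rinv_0_lt_compat|].
    rewrite Rmult_assoc, Rinv_r by lra. unfold Rdiv in HJ. lra. }
  set (T := fun j => INR j * a j + INR (S j) * a (S j)).
  assert (HT : forall j, (J <= j)%nat -> eps * a j <= T j - T (S j)).
  { intros j Hj. apply le_INR in Hj. pose proof (pos_INR j) as Hj0.
    pose proof (green_term_telescope b 0 j) as E. simpl (INR 0) in E.
    rewrite green_term_up in E. simpl (INR 0) in E.
    change (Z.of_nat 0) with 0%Z in E. fold a in E.
    unfold T. replace (INR j * a j + INR (S j) * a (S j)
      - (INR (S j) * a (S j) + INR (S (S j)) * a (S (S j))))
      with ((INR j - 0) * a j - (INR (S (S j)) - 0) * a (S (S j))) by ring.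
    rewrite <- E.
    replace ((0 + 1 - b) * (a j * ((INR j + b) / (INR j + 0 + 2))) - (0 + b) * a j)
      with (a j * (((1 - b) * (INR j + b) - b * (INR j + 2)) / (INR j + 2)))
      by (field; lra).
    rewrite (Rmult_comm eps). apply Rmult_le_compat_l; auto.
    apply Rmult_le_reg_r with (INR j + 2); [lra|].
    unfold Rdiv. rewrite Rmult_assoc, Rinv_l by lra.
    assert (HjE : 2 <= INR j * eps) by nra. unfold eps in *. nra. }
  apply ex_series_incr_n with J.
  destruct (is_series_bounded (fun k => a (J + k)%nat) (T J / eps)) as [l [Hl _]]; auto.
  - intros n. apply Rmult_le_reg_r with (1 := Heps).
    unfold Rdiv. rewrite Rmult_assoc, Rinv_l by lra.
    assert (H : sum_n (fun k => a (J + k)%nat) n * eps <= T J - T (J + S n)%nat).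
    { induction n as [|n IH].
      - rewrite sum_O. specialize (HT J (le_n J)).
        rewrite Nat.add_0_r, Nat.add_1_r. lra.
      - rewrite sum_n_S. specialize (HT (J + S n)%nat ltac:(lia)).
        rewrite (Nat.add_succ_r J (S n)). lra. }
    assert (0 <= T (J + S n)%nat); [|lra].
    apply Rplus_le_le_0_compat; apply Rmult_le_pos; auto; apply pos_INR.
  - now exists l.
Qed.

Lemma green_term_opp (b : R) (z : Z) (j : nat) : green_term b (- z) j = green_term b z j.
Proof. unfold green_term; now rewrite srw_opp. Qed.

Lemma green_opp (b : R) (z : Z) : green b (- z) = green b z.
Proof. apply Series_ext; intros; apply green_term_opp. Qed.

Lemma Z_abs_nat_cases (z : Z) : z = Z.of_nat (Z.abs_nat z) \/ z = (- Z.of_nat (Z.abs_nat z))%Z.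
Proof. lia. Qed.

Lemma is_series_green (b : R) (z : Z) : 0 < b < / 2 -> is_series (green_term b z) (green b z).
Proof.
  intros Hb. apply Series_correct.
  assert (H : forall n, ex_series (green_term b (Z.of_nat n))).
  { induction n as [|n [l Hl]]; [now apply green_term_0_summable|].
    destruct (is_series_dominated (fun j => green_term b (Z.of_nat (S n)) (S j))
      (green_term b (Z.of_nat n)) l)
      with (2 := Hl) as [m [Hm _]].
    - intros j; split; [apply green_term_nonneg; lra|now apply green_term_up_le].
    - eexists. apply is_series_decr, Hm. }
  destruct (Z_abs_nat_cases z) as [-> | ->]; auto.
  apply ex_series_ext with (green_term b (Z.of_nat (Z.abs_nat z))); auto.
  intros j; symmetry; apply green_term_opp.
Qed.

(** This is the boundary term of the telescoping sum. At n = 0 the bounds on [coef] and on the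
    return probability give (j+1)^(b - 1/2). The diagonal shift keeps j - n and does not increase
    the term, which carries the limit to every n. *)
Lemma green_term_lim (b : R) (n : nat) : 0 < b < / 2 ->
  is_lim_seq (fun j => (INR j - INR n) * green_term b (Z.of_nat n) j) 0.
Proof.
  intros Hb. induction n as [|n IH].
  - apply is_lim_seq_le_le with (fun _ => 0) (fun j => Rpower (INR (S j)) (- (/ 2 - b))).
    + intros j. pose proof (green_term_nonneg b (Z.of_nat 0) j ltac:(lra)) as Hg.
      pose proof (pos_INR j) as Hj. simpl (INR 0). split; [nra|].
      apply Rle_trans with (INR (S j) * green_term b (Z.of_nat 0) j).
      { rewrite S_INR; nra. }
      replace (Rpower (INR (S j)) (- (/ 2 - b))) with
        (INR (S j) * (Rpower (INR (S j)) (- (1 - b)) * Rpower (INR (S j)) (- / 2))).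
      * apply Rmult_le_compat_l; [apply pos_INR|].
        apply Rmult_le_compat;
          [left; apply coef_pos; lra|apply srw_nonneg|apply coef_le_Rpower; lra
          |apply srw_return_le].
      * rewrite <- (Rpower_1 (INR (S j))) at 1 by apply INR_S_pos.
        rewrite <- !Rpower_plus. f_equal. field.
    + apply is_lim_seq_const.
    + apply Rpower_neg_lim; lra.
  - apply is_lim_seq_incr_1.
    apply is_lim_seq_abs_0.
    apply is_lim_seq_le_le with (fun _ => 0)
      (fun j => Rabs ((INR j - INR n) * green_term b (Z.of_nat n) j)).
    + intros j. split; [apply Rabs_pos|].
      rewrite !S_INR. replace (INR j + 1 - (INR n + 1)) with (INR j - INR n) by ring.
      rewrite !Rabs_mult. apply Rmult_le_compat_l; [apply Rabs_pos|].
      rewrite !Rabs_pos_eq by (apply green_term_nonneg; lra).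
      now apply green_term_up_le.
    + apply is_lim_seq_const.
    + now apply is_lim_seq_abs_0 in IH.
Qed.

Lemma sum_two_step_telescope (u : nat -> R) (n : nat) :
  sum_n (fun j => u j - u (S (S j))) n = u 0%nat + u 1%nat - u (S n) - u (S (S n)) :> R.
Proof.
  induction n as [|n IH]; [rewrite sum_O; ring|]. rewrite sum_n_S, IH. ring.
Qed.

Lemma green_rec (b : R) (n : nat) : 0 < b < / 2 ->
  (INR n + 1 - b) * green b (Z.of_nat (S n)) = (INR n + b) * green b (Z.of_nat n).
Proof.
  intros Hb.
  set (u := fun j => (INR j - INR n) * green_term b (Z.of_nat n) j).
  assert (Hu : is_lim_seq u 0) by now apply green_term_lim.
  (* The certificate telescopes with step 2, so two lower boundary terms remain. Each vanishes
     through the factor j - n, or because n is out of reach, or, for n = 0 and j = 1, by parity. *)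
  assert (Hu01 : u 0%nat = 0 /\ u 1%nat = 0).
  { unfold u, green_term. destruct n as [|[|n]].
    - simpl; split; [ring|]. unfold Rdiv; ring.
    - split; [|simpl; ring]. rewrite srw_far by (simpl; lia). ring.
    - rewrite !srw_far by lia. split; ring. }
  destruct Hu01 as [Hu0 Hu1].
  pose (v := fun j => (INR n + 1 - b) * green_term b (Z.of_nat (S n)) (S j)
               + (- (INR n + b)) * green_term b (Z.of_nat n) j).
  assert (H1 : is_series v ((INR n + 1 - b) * (green b (Z.of_nat (S n)) - 0)
      + (- (INR n + b)) * green b (Z.of_nat n))).
  { apply is_series_Rplus; apply is_series_Rscal.
    - apply (is_series_eq _ _ _ _ (is_series_incr _ _ (is_series_green b (Z.of_nat (S n)) Hb)));
        auto.
      unfold green_term at 1. rewrite srw_far by lia. ring.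
    - now apply is_series_green. }
  assert (H2 : is_series v 0).
  { apply is_series_lim.
    apply is_lim_seq_ext with (fun m => 0 - u (S m) - u (S (S m))).
    - intros m.
      transitivity (u 0%nat + u 1%nat - u (S m) - u (S (S m))); [rewrite Hu0, Hu1; ring|].
      rewrite <- sum_two_step_telescope. apply sum_n_eq. intros k _. unfold u, v.
      rewrite <- green_term_telescope. ring.
    - replace (Finite 0) with (Finite (0 - 0 - 0)) by (f_equal; ring).
      assert (Hu' : is_lim_seq (fun m => u (S m)) 0) by now apply (is_lim_seq_incr_1 u).
      apply is_lim_seq_minus'; [apply is_lim_seq_minus'; [apply is_lim_seq_const|auto]|].
      now apply (is_lim_seq_incr_1 (fun m => u (S m))). }
  pose proof (is_series_unique _ _ H1) as E1. pose proof (is_series_unique _ _ H2) as E2.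
  rewrite E2 in E1. lra.
Qed.

Lemma green_nat_S (b : R) (n : nat) : 0 < b < / 2 ->
  green b (Z.of_nat (S n)) = green b (Z.of_nat n) * ((INR n + b) / (INR n + 1 - b)).
Proof.
  intros Hb. pose proof (pos_INR n). pose proof (green_rec b n Hb) as E.
  apply Rmult_eq_reg_l with (INR n + 1 - b); [|lra]. rewrite E. field. lra.
Qed.

Lemma green_0_ge_1 (b : R) : 0 < b < / 2 -> 1 <= green b 0.
Proof.
  intros Hb. replace 1 with (green_term b 0 0) by (unfold green_term; simpl; ring).
  apply (term_le_is_series (green_term b 0)); [|now apply is_series_green].
  intros k; apply green_term_nonneg; lra.
Qed.

Lemma green_pos (b : R) (z : Z) : 0 < b < / 2 -> 0 < green b z.
Proof.
  intros Hb.
  assert (H : forall n, 0 < green b (Z.of_nat n)).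
  { induction n as [|n IH].
    - pose proof (green_0_ge_1 b Hb). simpl; lra.
    - pose proof (pos_INR n). rewrite green_nat_S by auto.
      apply Rmult_lt_0_compat; auto. apply Rdiv_lt_0_compat; lra. }
  destruct (Z_abs_nat_cases z) as [-> | ->]; rewrite ?green_opp; auto.
Qed.

Lemma green_nat_decr (b : R) (m n : nat) : 0 < b < / 2 -> (m <= n)%nat ->
  green b (Z.of_nat n) <= green b (Z.of_nat m).
Proof.
  intros Hb H; induction H as [|n H IH]; [lra|].
  apply Rle_trans with (2 := IH). pose proof (pos_INR n).
  pose proof (green_rec b n Hb). pose proof (green_pos b (Z.of_nat n) Hb).
  apply Rmult_le_reg_l with (INR n + 1 - b); [lra|]. nra.
Qed.

Lemma green_abs (b : R) (z : Z) : green b (Z.abs z) = green b z.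
Proof. destruct (Z.abs_spec z) as [[_ ->]|[_ ->]]; [auto|apply green_opp]. Qed.

Lemma green_decr (b : R) (y z : Z) : 0 < b < / 2 -> (Z.abs y <= Z.abs z)%Z ->
  green b z <= green b y.
Proof.
  intros Hb H. rewrite <- (green_abs b y), <- (green_abs b z).
  rewrite <- (Z2Nat.id (Z.abs y)), <- (Z2Nat.id (Z.abs z)) by lia.
  apply green_nat_decr; auto. lia.
Qed.

(** By the recurrence G(n)/G(n+1) = (n+1-b)/(n+b), which is largest at n = 0; this is the constant.
    Monotonicity in the absolute value reduces to |y| = |z| + 1. *)
Lemma green_harnack (b : R) (y z : Z) : 0 < b < / 2 -> (Z.abs y <= Z.abs z + 1)%Z ->
  green b z <= (1 - b) / b * green b y.
Proof.
  intros Hb H. pose proof (green_pos b y Hb) as Hy.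
  pose proof (pos_INR (Z.abs_nat z)) as Hn.
  pose proof (green_rec b (Z.abs_nat z) Hb) as E.
  replace (green b (Z.of_nat (Z.abs_nat z))) with (green b z) in E
    by (rewrite Zabs2Nat.id_abs; symmetry; apply green_abs).
  apply Rle_trans with ((1 - b) / b * green b (Z.of_nat (S (Z.abs_nat z)))).
  - pose proof (green_pos b (Z.of_nat (S (Z.abs_nat z))) Hb) as Hg.
    set (g := green b (Z.of_nat (S (Z.abs_nat z)))) in *.
    apply Rmult_le_reg_l with ((INR (Z.abs_nat z) + b) * b); [nra|].
    replace ((INR (Z.abs_nat z) + b) * b * ((1 - b) / b * g))
      with ((INR (Z.abs_nat z) + b) * (1 - b) * g) by (field; lra).
    replace ((INR (Z.abs_nat z) + b) * b * green b z)
      with (b * ((INR (Z.abs_nat z) + b) * green b z)) by ring.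
    rewrite <- E.
    replace (b * ((INR (Z.abs_nat z) + 1 - b) * g))
      with (b * (INR (Z.abs_nat z) + 1 - b) * g) by ring.
    apply Rmult_le_compat_r; nra.
  - apply Rmult_le_compat_l; [|apply green_decr; auto; lia].
    left; apply Rdiv_lt_0_compat; lra.
Qed.

(** G(m) (m+b)^(1-2b) is nonincreasing. The shift by b is chosen so that the Bernoulli bound for the
    power, (m+1-b)/(m+b), is exactly the inverse of G(m+1)/G(m). *)
Lemma green_upper (b : R) (n : nat) : 0 < b < / 2 ->
  green b (Z.of_nat (S n)) * Rpower (INR (S n)) (1 - 2 * b) <= green b 0.
Proof.
  intros Hb.
  assert (H : forall m, green b (Z.of_nat m) * Rpower (INR m + b) (1 - 2 * b) <= green b 0).
  { induction m as [|m IH].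
    - simpl (INR 0). rewrite Rplus_0_l.
      change (Z.of_nat 0) with 0%Z. rewrite <- (Rmult_1_r (green b 0)) at 2.
      apply Rmult_le_compat_l; [left; now apply green_pos|].
      replace 1 with (Rpower 1 (1 - 2 * b)) at 2
        by (unfold Rpower; rewrite ln_1, Rmult_0_r; apply exp_0).
      apply Rle_Rpower_l; lra.
    - apply Rle_trans with (2 := IH). pose proof (pos_INR m) as Hm.
      replace (INR (S m) + b) with ((INR m + b) * (1 + / (INR m + b)))
        by (rewrite S_INR; field; lra).
      assert (Hi : 0 < / (INR m + b)) by (apply Rinv_0_lt_compat; lra).
      rewrite <- Rpower_mult_distr by lra.
      rewrite green_nat_S by auto.
      pose proof (Rpower_bernoulli (1 - 2 * b) (/ (INR m + b)) ltac:(lra) ltac:(lra)) as HB.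
      pose proof (green_pos b (Z.of_nat m) Hb) as Hg.
      pose proof (Rpower_pos (INR m + b) (1 - 2 * b)) as Hp.
      set (q := Rpower (1 + / (INR m + b)) (1 - 2 * b)) in *.
      assert (Hq : (INR m + b) / (INR m + 1 - b) * q <= 1).
      { apply Rle_trans with ((INR m + b) / (INR m + 1 - b)
          * (1 + (1 - 2 * b) * / (INR m + b))).
        - apply Rmult_le_compat_l; auto. left; apply Rdiv_lt_0_compat; lra.
        - right. field. lra. }
      set (g := green b (Z.of_nat m)) in *. set (p := Rpower (INR m + b) (1 - 2 * b)) in *.
      replace (g * ((INR m + b) / (INR m + 1 - b)) * (p * q))
        with (g * p * ((INR m + b) / (INR m + 1 - b) * q)) by ring.
      rewrite <- (Rmult_1_r (g * p)) at 2. apply Rmult_le_compat_l; nra. }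
  apply Rle_trans with (2 := H (S n)).
  apply Rmult_le_compat_l; [left; now apply green_pos|].
  apply Rle_Rpower_l; [lra|]. pose proof (INR_S_pos n); lra.
Qed.

(** Here G(m) (m-b)^(1-2b) is nondecreasing for m >= 1: writing m-b as (m+1-b)(1 - 1/(m+1-b)), the
    Bernoulli bound for the second factor is (m+b)/(m+1-b), which equals G(m+1)/G(m). The constant
    is the value at m = 1. *)
Lemma green_lower (b : R) : 0 < b < / 2 -> exists c, 0 < c /\
  forall n, c <= green b (Z.of_nat (S n)) * Rpower (INR (S n)) (1 - 2 * b).
Proof.
  intros Hb. exists (green b 1 * Rpower (1 - b) (1 - 2 * b)). split.
  { apply Rmult_lt_0_compat; [now apply green_pos|apply Rpower_pos]. }
  assert (H : forall m, green b 1 * Rpower (1 - b) (1 - 2 * b)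
      <= green b (Z.of_nat (S m)) * Rpower (INR (S m) - b) (1 - 2 * b)).
  { induction m as [|m IH]; [apply Rle_refl|].
    apply Rle_trans with (1 := IH). pose proof (INR_S_pos m) as Hm0.
    assert (Hm : 1 <= INR (S m)) by (rewrite S_INR; pose proof (pos_INR m); lra).
    rewrite (green_nat_S b (S m)) by auto. rewrite (S_INR (S m)).
    set (x := INR (S m)) in *.
    pose proof (green_pos b (Z.of_nat (S m)) Hb) as Hg.
    set (g := green b (Z.of_nat (S m))) in *.
    assert (Hi : 0 < / (x + 1 - b) < 1).
    { split; [apply Rinv_0_lt_compat; lra|]. rewrite <- Rinv_1.
      apply Rinv_lt_contravar; lra. }
    pose proof (Rpower_bernoulli (1 - 2 * b) (- / (x + 1 - b)) ltac:(lra) ltac:(lra)) as HB.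
    replace (x - b) with ((x + 1 - b) * (1 + - / (x + 1 - b))) by (field; lra).
    rewrite <- Rpower_mult_distr by lra.
    pose proof (Rpower_pos (x + 1 - b) (1 - 2 * b)) as Hp.
    set (q := Rpower (1 + - / (x + 1 - b)) (1 - 2 * b)) in *.
    replace (1 + (1 - 2 * b) * - / (x + 1 - b)) with ((x + b) / (x + 1 - b)) in HB
      by (field; lra).
    set (p := Rpower (x + 1 - b) (1 - 2 * b)) in *.
    set (w := (x + b) / (x + 1 - b)) in *.
    apply Rle_trans with (g * p * w); [|right; ring].
    rewrite <- Rmult_assoc. apply Rmult_le_compat_l; nra. }
  intros n. apply Rle_trans with (1 := H n).
  apply Rmult_le_compat_l; [left; now apply green_pos|].
  apply Rle_Rpower_l; [lra|]. rewrite S_INR; pose proof (pos_INR n); lra.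
Qed.

Lemma green_lim (b : R) : 0 < b < / 2 -> is_lim_seq (fun n => green b (Z.of_nat n)) 0.
Proof.
  intros Hb. apply is_lim_seq_incr_1.
  apply is_lim_seq_le_le with (fun _ => 0)
    (fun n => green b 0 * Rpower (INR (S n)) (- (1 - 2 * b))).
  - intros n; split; [left; now apply green_pos|].
    rewrite Rpower_Ropp. pose proof (Rpower_pos (INR (S n)) (1 - 2 * b)).
    apply Rmult_le_reg_r with (Rpower (INR (S n)) (1 - 2 * b)); auto.
    rewrite Rmult_assoc, Rinv_l, Rmult_1_r by lra. now apply green_upper.
  - apply is_lim_seq_const.
  - replace (Finite 0) with (Rbar_mult (green b 0) 0) by (simpl; f_equal; ring).
    apply is_lim_seq_scal_l, Rpower_neg_lim; lra.
Qed.

(** * The kernel of the stable walk acting on functions *)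

Fixpoint walk (k : nat) (f : Z -> R) (x : Z) : R :=
  match k with
  | O => f x
  | S m => (walk m f (x - 1) + walk m f (x + 1)) / 2
  end.

Lemma is_series_single (u : nat -> R) (n : nat) :
  (forall k, k <> n -> u k = 0) -> is_series u (u n).
Proof.
  intros H. apply is_series_shift with n; [intros k Hk; apply H; lia|].
  apply is_series_eq with (fun k => u (n + k)%nat) (sum_n (fun k => u (n + k)%nat) 0); auto.
  - apply is_series_finite. intros k Hk; apply H; lia.
  - rewrite sum_O, Nat.add_0_r; auto.
Qed.

Lemma is_sumZ_srw (k : nat) (f : Z -> R) (x : Z) :
  is_sumZ (fun y => srw k (y - x) * f y) (walk k f x).
Proof.
  revert x; induction k as [|k IH]; intros x.
  - assert (H : forall y, y <> x -> srw 0 (y - x) * f y = 0).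
    { intros y Hy. rewrite srw_far by lia. ring. }
    apply is_series_eq with (foldZ (fun y => srw 0 (y - x) * f y))
      (foldZ (fun y => srw 0 (y - x) * f y) (Z.abs_nat x)); auto.
    + apply is_series_single. intros [|n] Hn; unfold foldZ.
      * apply H; lia.
      * rewrite !H by lia. ring.
    + assert (Hx : srw 0 (x - x) * f x = f x).
      { rewrite Z.sub_diag. simpl; ring. }
      unfold walk. destruct (Z.abs_nat x) as [|n] eqn:E.
      * replace x with 0%Z in * by lia. exact Hx.
      * unfold foldZ. destruct (Z_abs_nat_cases x) as [Ex|Ex]; rewrite E in Ex; rewrite <- Ex.
        -- rewrite Hx, (H (- x)%Z) by lia. ring.
        -- rewrite Hx, (H (Z.of_nat (S n))) by lia. ring.
  - apply (is_sumZ_eq _ _ _ _ (is_sumZ_scal (/ 2) _ _ (is_sumZ_plus _ _ _ _ (IH (x - 1)%Z)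
      (IH (x + 1)%Z)))).
    + intros y. rewrite srw_S. replace (y - (x - 1))%Z with (y - x + 1)%Z by lia.
      replace (y - (x + 1))%Z with (y - x - 1)%Z by lia. field.
    + simpl. field.
Qed.

Lemma is_series_kernel (alpha : R) (z : Z) : 0 < alpha < 1 ->
  is_series (fun k => stable_coef alpha (S k) * srw (S k) z) (stable_kernel alpha z).
Proof.
  intros H. apply Series_correct.
  destruct (is_series_dominated (fun k => stable_coef alpha (S k) * srw (S k) z)
    (fun k => stable_coef alpha (S k)) 1) as [m [Hm _]].
  - intros k. pose proof (stable_coef_pos alpha k H).
    pose proof (srw_nonneg (S k) z). pose proof (srw_le_1 (S k) z). nra.
  - now apply is_series_stable_coef.
  - now exists m.
Qed.

Lemma kernel_nonneg (alpha : R) (z : Z) : 0 < alpha < 1 -> 0 <= stable_kernel alpha z.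
Proof.
  intros H. apply (is_series_nonneg _ _) with (2 := is_series_kernel alpha z H).
  intros k. apply Rmult_le_pos; [left; now apply stable_coef_pos|apply srw_nonneg].
Qed.

(** The form of irreducibility used by [maximum_principle]: a step to the right neighbour has
    positive probability. *)
Lemma kernel_1_pos (alpha : R) : 0 < alpha < 1 -> 0 < stable_kernel alpha 1.
Proof.
  intros H. apply Rlt_le_trans with (stable_coef alpha 1 * srw 1 1).
  - apply Rmult_lt_0_compat; [now apply stable_coef_pos|]. simpl; lra.
  - apply (term_le_is_series (fun k => stable_coef alpha (S k) * srw (S k) 1) _ 0)
      with (2 := is_series_kernel alpha 1 H).
    intros k. apply Rmult_le_pos; [left; now apply stable_coef_pos|apply srw_nonneg].
Qed.

(** For f >= 0, Tonelli turns the action of P_alpha into the mixture of the P^k f with weights c_k.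
    Each [walk k f] is a finite average, so only one series over k remains to be controlled. *)
Lemma is_sumZ_kernel (alpha : R) (f : Z -> R) (x : Z) (l : R) : 0 < alpha < 1 ->
  (forall y, 0 <= f y) ->
  is_series (fun k => stable_coef alpha (S k) * walk (S k) f x) l ->
  is_sumZ (fun y => stable_kernel alpha (y - x) * f y) l.
Proof.
  intros H Hf.
  apply (is_sumZ_tonelli (fun k y => stable_coef alpha (S k) * (srw (S k) (y - x) * f y))).
  - intros k y. apply Rmult_le_pos; [left; now apply stable_coef_pos|].
    apply Rmult_le_pos; [apply srw_nonneg|auto].
  - intros k. apply is_sumZ_scal, is_sumZ_srw.
  - intros y. apply (is_series_eq _ _ _ _
      (is_series_scal_r (f y) _ _ (is_series_kernel alpha (y - x) H))); auto.
    intros n; ring.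
Qed.

Lemma is_sumZ_kernel_1 (alpha : R) (x : Z) : 0 < alpha < 1 ->
  is_sumZ (fun y => stable_kernel alpha (y - x) * 1) 1.
Proof.
  intros H. apply (is_sumZ_kernel alpha (fun _ => 1)); auto; [intros; lra|].
  apply (is_series_eq _ _ _ _ (is_series_stable_coef alpha H)); auto.
  assert (Hw : forall k y, walk k (fun _ => 1) y = 1).
  { induction k as [|k IH]; intros y; simpl; [auto|]. rewrite !IH; field. }
  intros k. rewrite Hw; ring.
Qed.

Lemma walk_green (b : R) (a : Z) (k : nat) (x : Z) : 0 < b < / 2 ->
  is_series (fun j => coef (1 - b) j * srw (k + j) (a - x))
    (walk k (fun y => green b (a - y)) x).
Proof.
  intros Hb. revert x; induction k as [|k IH]; intros x; [now apply is_series_green|].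
  apply (is_series_eq _ _ _ _ (is_series_Rscal (/ 2) _ _
    (is_series_Rplus _ _ _ _ (IH (x - 1)%Z) (IH (x + 1)%Z)))).
  - intros j. simpl Nat.add. rewrite srw_S.
    replace (a - (x - 1))%Z with (a - x + 1)%Z by lia.
    replace (a - (x + 1))%Z with (a - x - 1)%Z by lia. field.
  - simpl. field.
Qed.

(* With [c] the coefficients of [1-(1-s)^b] and [d] those of [(1-s)^(-b)], summing
   [c_i d_j P^(i+j)] along [i+j = n] gives [d_n P^n] for [n >= 1]. *)
Lemma green_equation (alpha : R) (a x : Z) : 0 < alpha < 1 ->
  is_sumZ (fun y => stable_kernel alpha (y - x) * green (alpha / 2) (a - y))
    (green (alpha / 2) (a - x) - srw 0 (a - x)).
Proof.
  intros H. set (b := alpha / 2). assert (Hb : 0 < b < / 2) by (unfold b; lra).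
  apply is_sumZ_kernel; auto; [intros y; left; now apply green_pos|].
  (* Row n collects the total power P^(n+1) and column i the coefficient c_(i+1); the triangular
     array is padded by 0 where i > n. *)
  set (f := fun n i => if le_dec i n
    then stable_coef alpha (S i) * coef (1 - b) (n - i) * srw (S n) (a - x) else 0).
  assert (Hrow : forall n, is_series (f n) (green_term b (a - x) (S n))).
  { intros n. apply is_series_eq with (f n) (sum_n (f n) n); auto.
    - apply is_series_finite. intros k Hk. unfold f. destruct (le_dec k n); [lia|auto].
    - pose proof (coef_convolution (1 + b) (1 - b) n ltac:(ring)) as E.
      rewrite sum_n_S_left in E. rewrite Nat.sub_0_r in E. simpl (coef (1 + b) 0) in E.
      transitivity (srw (S n) (a - x)
        * (-1 * sum_n (fun i => coef (1 + b) (S i) * coef (1 - b) (S n - S i)) n)).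
      + rewrite <- !sum_n_Rscal. apply sum_n_eq. intros k Hk. unfold f.
        destruct (le_dec k n); [|lia]. rewrite stable_coef_coef. fold b.
        replace (S n - S k)%nat with (n - k)%nat by lia. ring.
      + unfold green_term. set (S1 := (sum_n _ n : R)) in *.
        replace S1 with (- coef (1 - b) (S n)) by lra. ring. }
  apply (series_tonelli_columns f (fun n => green_term b (a - x) (S n))); auto.
  - intros n i. unfold f. destruct (le_dec i n); [|lra].
    apply Rmult_le_pos; [apply Rmult_le_pos|apply srw_nonneg].
    + left; now apply stable_coef_pos.
    + left; apply coef_pos; lra.
  - intros i. apply is_series_shift with i.
    + intros k Hk. unfold f. destruct (le_dec i k); [lia|auto].
    + apply (is_series_eq _ _ _ _ (is_series_Rscal (stable_coef alpha (S i)) _ _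
        (walk_green b a (S i) x Hb))); auto.
      intros j. unfold f. destruct (le_dec i (i + j)); [|lia].
      replace (i + j - i)%nat with j by lia. rewrite Nat.add_succ_l. ring.
  - apply (is_series_eq _ _ _ _ (is_series_incr _ _ (is_series_green b (a - x) Hb))); auto.
    unfold green_term. simpl coef. now rewrite Rmult_1_l.
Qed.

(** * Hitting probabilities *)

Definition superharmonic (alpha : R) (v : Z -> R) : Prop :=
  forall x, exists l, is_sumZ (fun y => stable_kernel alpha (y - x) * v y) l /\ l <= v x.

Lemma is_sumZ_kernel_bounded (alpha : R) (f : Z -> R) (x : Z) : 0 < alpha < 1 ->
  (forall y, 0 <= f y <= 1) ->
  exists l, is_sumZ (fun y => stable_kernel alpha (y - x) * f y) l /\ 0 <= l <= 1.
Proof.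
  intros H Hf.
  assert (Hk : forall y, 0 <= stable_kernel alpha (y - x) * f y
                         <= stable_kernel alpha (y - x) * 1).
  { intros y. pose proof (kernel_nonneg alpha (y - x) H). pose proof (Hf y). split; nra. }
  destruct (is_sumZ_dominated _ _ _ Hk (is_sumZ_kernel_1 alpha x H)) as [l [Hl Hl1]].
  exists l; repeat split; auto.
  apply (is_series_nonneg _ _) with (2 := Hl). intros n; apply foldZ_nonneg; apply Hk.
Qed.

Lemma hit_within_in (alpha : R) (B : Z -> Prop) (n : nat) (x : Z) :
  B x -> hit_within alpha B n x = 1.
Proof. intros Hx; destruct n; simpl; destruct (excluded_middle_informative (B x)); tauto. Qed.

Lemma hit_within_bounds (alpha : R) (B : Z -> Prop) (n : nat) (x : Z) : 0 < alpha < 1 ->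
  0 <= hit_within alpha B n x <= 1.
Proof.
  intros H; revert x; induction n as [|n IH]; intros x; simpl;
    destruct (excluded_middle_informative (B x)); try lra.
  destruct (is_sumZ_kernel_bounded alpha (hit_within alpha B n) x H IH) as [l [Hl Hb]].
  now rewrite (is_sumZ_unique _ _ Hl).
Qed.

Lemma hit_within_out (alpha : R) (B : Z -> Prop) (n : nat) (x : Z) : 0 < alpha < 1 -> ~ B x ->
  is_sumZ (fun y => stable_kernel alpha (y - x) * hit_within alpha B n y)
    (hit_within alpha B (S n) x).
Proof.
  intros H Hx. simpl. destruct (excluded_middle_informative (B x)); [tauto|].
  destruct (is_sumZ_kernel_bounded alpha (hit_within alpha B n) x H) as [l [Hl _]].
  - intros y; now apply hit_within_bounds.
  - now rewrite (is_sumZ_unique _ _ Hl).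
Qed.

(** Optional stopping for a nonnegative supermartingale, by induction on time: off [B] one step
    averages both sides, and on [B] the bound is 1 <= v. *)
Lemma hit_within_le_superharmonic (alpha : R) (B : Z -> Prop) (v : Z -> R) (n : nat) (x : Z) :
  0 < alpha < 1 -> superharmonic alpha v -> (forall y, 0 <= v y) ->
  (forall y, B y -> 1 <= v y) -> hit_within alpha B n x <= v x.
Proof.
  intros H Hs Hv HB. revert x; induction n as [|n IH]; intros x;
    destruct (excluded_middle_informative (B x)) as [Hx|Hx];
    try (rewrite hit_within_in by exact Hx; now apply HB).
  - simpl. destruct (excluded_middle_informative (B x)); [tauto|auto].
  - destruct (Hs x) as [l [Hl Hlv]]. apply Rle_trans with (2 := Hlv).
    apply (is_sumZ_le _ _ _ _) with (2 := hit_within_out alpha B n x H Hx) (3 := Hl).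
    intros y. apply Rmult_le_compat_l; auto. now apply kernel_nonneg.
Qed.

Lemma hit_within_incr (alpha : R) (B : Z -> Prop) (n : nat) (x : Z) : 0 < alpha < 1 ->
  hit_within alpha B n x <= hit_within alpha B (S n) x.
Proof.
  intros H. revert x; induction n as [|n IH]; intros x;
    destruct (excluded_middle_informative (B x)) as [Hx|Hx];
    try (rewrite !hit_within_in by exact Hx; lra).
  - apply Rle_trans with 0; [|now apply hit_within_bounds].
    simpl. destruct (excluded_middle_informative (B x)); [tauto|lra].
  - apply (is_sumZ_le _ _ _ _)
      with (2 := hit_within_out alpha B n x H Hx) (3 := hit_within_out alpha B (S n) x H Hx).
    intros y. apply Rmult_le_compat_l; auto. now apply kernel_nonneg.
Qed.

Lemma is_lim_seq_sum_n (f : nat -> nat -> R) (l : nat -> R) (m : nat) :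
  (forall k, is_lim_seq (fun n => f n k) (l k)) ->
  is_lim_seq (fun n => sum_n (f n) m) (sum_n l m).
Proof.
  intros H; induction m as [|m IH].
  - apply is_lim_seq_ext with (fun n => f n 0%nat); [intros; now rewrite sum_O|].
    rewrite sum_O. apply H.
  - apply is_lim_seq_ext with (fun n => sum_n (f n) m + f n (S m));
      [intros; now rewrite sum_n_S|].
    rewrite sum_n_S. now apply is_lim_seq_plus'.
Qed.

(** On [B] superharmonicity only says that an average of values at most 1 is at most 1. Off [B] it
    is Fatou by hand: a truncated average of [hit_within] at time n is at most [hit_within] at time
    n+1, and a finite truncation passes to the limit term by term. *)
Lemma hitting_limit (alpha : R) (B : Z -> Prop) : 0 < alpha < 1 ->
  exists u : Z -> R,
    (forall x, is_lim_seq (fun n => hit_within alpha B n x) (u x)) /\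
    (forall x, 0 <= u x <= 1) /\ (forall x, B x -> u x = 1) /\ superharmonic alpha u.
Proof.
  intros H.
  assert (Hex : forall x, ex_finite_lim_seq (fun n => hit_within alpha B n x)).
  { intros x. apply ex_finite_lim_seq_incr with 1.
    - intros n; now apply hit_within_incr.
    - intros n; now apply hit_within_bounds. }
  exists (fun x => real (Lim_seq (fun n => hit_within alpha B n x))).
  set (u := fun x => real (Lim_seq (fun n => hit_within alpha B n x))).
  assert (Hu : forall x, is_lim_seq (fun n => hit_within alpha B n x) (u x)).
  { intros x. now apply Lim_seq_correct'. }
  assert (Hle : forall n x, hit_within alpha B n x <= u x).
  { intros n x. apply (is_lim_seq_incr_compare (fun n => hit_within alpha B n x)); auto.
    intros k; now apply hit_within_incr. }
  assert (Hb : forall x, 0 <= u x <= 1).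
  { intros x; split.
    - apply Rle_trans with (2 := Hle 0%nat x). now apply hit_within_bounds.
    - apply (is_lim_seq_le (fun n => hit_within alpha B n x) (fun _ => 1) (u x) 1); auto.
      + intros n; now apply hit_within_bounds.
      + apply is_lim_seq_const. }
  assert (HB : forall x, B x -> u x = 1).
  { intros x Hx. apply Rle_antisym; [apply Hb|].
    rewrite <- (hit_within_in alpha B 0 x Hx). apply Hle. }
  repeat split; auto; try apply Hb.
  intros x. destruct (excluded_middle_informative (B x)) as [Hx|Hx].
  - destruct (is_sumZ_kernel_bounded alpha u x H Hb) as [l [Hl Hl1]].
    exists l; split; auto. change (l <= u x). rewrite HB by exact Hx. lra.
  - apply is_series_bounded.
    + intros n; apply foldZ_nonneg. intros y.
      apply Rmult_le_pos; [now apply kernel_nonneg|apply Hb].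
    + intros m. set (g := fun n y => stable_kernel alpha (y - x) * hit_within alpha B n y).
      assert (Hg : forall y, is_lim_seq (fun n => g n y) (stable_kernel alpha (y - x) * u y)).
      { intros y. apply (is_lim_seq_scal_l _ (stable_kernel alpha (y - x)) (u y)), Hu. }
      apply (is_lim_seq_le (fun n => sum_n (foldZ (g n)) m)
        (fun n => hit_within alpha B (S n) x)
        (sum_n (foldZ (fun y => stable_kernel alpha (y - x) * u y)) m) (u x)).
      * intros n. apply sum_n_le_is_series; [|now apply hit_within_out].
        intros k; apply foldZ_nonneg. intros y.
        apply Rmult_le_pos; [now apply kernel_nonneg|now apply hit_within_bounds].
      * apply is_lim_seq_sum_n. intros [|k]; unfold foldZ; [apply Hg|].
        apply is_lim_seq_plus'; apply Hg.
      * apply (is_lim_seq_incr_1 (fun n => hit_within alpha B n x)), Hu.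
Qed.

Lemma is_sumZ_kernel_compl (alpha : R) (f : Z -> R) (x : Z) (l : R) : 0 < alpha < 1 ->
  is_sumZ (fun y => stable_kernel alpha (y - x) * f y) l ->
  is_sumZ (fun y => stable_kernel alpha (y - x) * (1 - f y)) (1 - l).
Proof.
  intros H Hl.
  apply (is_sumZ_eq _ _ _ _ (is_sumZ_plus _ _ _ _ (is_sumZ_kernel_1 alpha x H)
    (is_sumZ_scal (-1) _ _ Hl))); [intros y|]; ring.
Qed.

(* The escape probability [w = 1-u] satisfies [w <= K w] off [B], so [w <= 1-delta]
   propagates to [w <= (1-delta) P(no hit before n)], and then [w <= (1-delta) w]. *)
Lemma massive_of_uniform_hitting (alpha : R) (B : Z -> Prop) (u : Z -> R) (delta : R) :
  0 < alpha < 1 -> 0 < delta ->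
  (forall x, is_lim_seq (fun n => hit_within alpha B n x) (u x)) ->
  (forall x, B x -> u x = 1) -> superharmonic alpha u ->
  (forall x, delta <= u x <= 1) -> massive alpha B.
Proof.
  intros H Hd Hu HB Hs Hb.
  assert (Hw : forall n x, 1 - u x <= (1 - delta) * (1 - hit_within alpha B n x)).
  { induction n as [|n IH]; intros x;
      destruct (excluded_middle_informative (B x)) as [Hx|Hx];
      try (rewrite hit_within_in, HB by exact Hx; lra).
    - simpl. destruct (excluded_middle_informative (B x)); [tauto|].
      pose proof (Hb x); lra.
    - destruct (Hs x) as [l [Hl Hlu]]. apply Rle_trans with (1 - l); [lra|].
      apply (is_sumZ_le (fun y => stable_kernel alpha (y - x) * (1 - u y))
        (fun y => (1 - delta)
           * (stable_kernel alpha (y - x) * (1 - hit_within alpha B n y)))).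
      + intros y. rewrite <- Rmult_assoc, (Rmult_comm (1 - delta)), Rmult_assoc.
        apply Rmult_le_compat_l; auto. now apply kernel_nonneg.
      + now apply is_sumZ_kernel_compl.
      + apply is_sumZ_scal. apply is_sumZ_kernel_compl; auto. now apply hit_within_out. }
  intros x.
  assert (Hlim : 1 - u x <= (1 - delta) * (1 - u x)).
  { apply (is_lim_seq_le (fun _ => 1 - u x)
      (fun n => (1 - delta) * (1 - hit_within alpha B n x)) (1 - u x)
      ((1 - delta) * (1 - u x))); auto.
    - apply is_lim_seq_const.
    - apply (is_lim_seq_scal_l _ (1 - delta) (1 - u x)).
      apply is_lim_seq_minus'; [apply is_lim_seq_const|auto]. }
  assert (Hu1 : u x = 1) by (pose proof (Hb x); nra).
  rewrite <- Hu1. apply Hu.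
Qed.

(** * The maximum principle *)

Definition vanishes_at_infinity (g : Z -> R) : Prop :=
  forall eps, 0 < eps -> exists L : nat, forall x, (Z.of_nat L < Z.abs x)%Z -> g x < eps.

(** Taking the last maximizer makes the next value strictly smaller, which is what contradicts the
    mean value inequality in [maximum_principle]. *)
Lemma last_argmax (h : nat -> R) (n : nat) : exists k, (k <= n)%nat /\
  (forall j, (j <= n)%nat -> h j <= h k) /\ (forall j, (k < j <= n)%nat -> h j < h k).
Proof.
  induction n as [|n [k (Hk & Hm & Hs)]].
  - exists 0%nat; repeat split; auto; intros j Hj; [|lia].
    replace j with 0%nat by lia; lra.
  - destruct (Rle_lt_dec (h k) (h (S n))) as [Hc|Hc].
    + exists (S n); repeat split; auto; intros j Hj; [|lia].
      destruct (Nat.eq_dec j (S n)) as [->|Hne]; [lra|].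
      apply Rle_trans with (2 := Hc), Hm; lia.
    + exists k; repeat split; auto; intros j Hj.
      * destruct (Nat.eq_dec j (S n)) as [->|Hne]; [lra|]. apply Hm; lia.
      * destruct (Nat.eq_dec j (S n)) as [->|Hne]; [lra|]. apply Hs; lia.
Qed.

(** If f = g - M u were positive somewhere, it would have a rightmost maximum point z, lying outside
    [F]. At z the function f is subharmonic, so the kernel average of f z - f y is at most 0; yet
    its terms are nonnegative and the one at y = z+1 is positive. *)
Lemma maximum_principle (alpha : R) (F : Z -> Prop) (g u : Z -> R) (M : R) :
  0 < alpha < 1 -> 0 <= M -> (forall x, 0 <= u x) -> superharmonic alpha u ->
  vanishes_at_infinity g -> (forall x, F x -> g x <= M * u x) ->
  (forall x, ~ F x -> is_sumZ (fun y => stable_kernel alpha (y - x) * g y) (g x)) ->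
  forall x, g x <= M * u x.
Proof.
  intros H HM Hu Hs Hg HF Hh x0. apply Rnot_lt_le. intros Hx0.
  set (f := fun x => g x - M * u x).
  assert (Hfg : forall x, f x <= g x) by (intros x; unfold f; pose proof (Hu x); nra).
  assert (Hf0 : 0 < f x0) by (unfold f; lra).
  destruct (Hg (f x0) Hf0) as [L0 HL0].
  (* The window [-L, L] contains [x0], and outside it f <= g < f x0; a maximum over the window is
     therefore global. *)
  pose (L := (L0 + Z.abs_nat x0)%nat).
  destruct (last_argmax (fun k => f (Z.of_nat k - Z.of_nat L)%Z) (2 * L)) as [k (Hk & Hm & Hst)].
  set (z := (Z.of_nat k - Z.of_nat L)%Z) in *.
  assert (Hrange : forall y, (Z.abs y <= Z.of_nat L)%Z -> exists j, (j <= 2 * L)%nat /\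
    y = (Z.of_nat j - Z.of_nat L)%Z).
  { intros y Hy. exists (Z.to_nat (y + Z.of_nat L)). split; lia. }
  assert (Hz0 : f x0 <= f z).
  { destruct (Hrange x0) as [j [Hj Ej]]; [unfold L; lia|]. rewrite Ej. now apply Hm. }
  assert (Hout : forall y, (Z.of_nat L < Z.abs y)%Z -> f y < f z).
  { intros y Hy. apply Rle_lt_trans with (1 := Hfg y), Rlt_le_trans with (2 := Hz0).
    apply HL0. unfold L in Hy; lia. }
  assert (Hmax : forall y, f y <= f z).
  { intros y. destruct (Z_lt_le_dec (Z.of_nat L) (Z.abs y)) as [Hy|Hy].
    - left; auto.
    - destruct (Hrange y Hy) as [j [Hj ->]]. now apply Hm. }
  assert (Hnext : f (z + 1)%Z < f z).
  { destruct (Z_lt_le_dec (Z.of_nat L) (Z.abs (z + 1))) as [Hy|Hy]; [auto|].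
    destruct (Hrange _ Hy) as [j [Hj Ej]]. rewrite Ej. apply Hst. unfold z in Ej; lia. }
  assert (HzF : ~ F z).
  { intros Hz. pose proof (HF z Hz). unfold f in Hz0 at 2. lra. }
  destruct (Hs z) as [l [Hl Hlu]].
  assert (Hsum : is_sumZ (fun y => stable_kernel alpha (y - z) * (f z - f y))
    (f z * 1 + (-1 * g z + M * l))).
  { apply (is_sumZ_eq _ _ _ _ (is_sumZ_plus _ _ _ _
      (is_sumZ_scal (f z) _ _ (is_sumZ_kernel_1 alpha z H))
      (is_sumZ_plus _ _ _ _ (is_sumZ_scal (-1) _ _ (Hh z HzF)) (is_sumZ_scal M _ _ Hl))));
      auto.
    intros y. unfold f. ring. }
  assert (Hterm : stable_kernel alpha (z + 1 - z) * (f z - f (z + 1)%Z)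
    <= f z * 1 + (-1 * g z + M * l)).
  { apply (is_sumZ_term_le (fun y => stable_kernel alpha (y - z) * (f z - f y)));
      [|exact Hsum].
    intros y. apply Rmult_le_pos; [now apply kernel_nonneg|]. specialize (Hmax y); lra. }
  replace (z + 1 - z)%Z with 1%Z in Hterm by lia.
  pose proof (kernel_1_pos alpha H) as HK.
  assert (0 < stable_kernel alpha 1 * (f z - f (z + 1)%Z)) by (apply Rmult_lt_0_compat; lra).
  assert (M * l <= M * u z) by now apply Rmult_le_compat_l.
  change (f z) with (g z - M * u z) in Hterm at 2. lra.
Qed.

(** * Potentials of a superlinear sequence *)

(** The poles are a 1, ..., a (N+1): the value [a 0] does not belong to the sequence. *)
Definition green_sum (b : R) (a : nat -> nat) (N : nat) (x : Z) : R :=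
  sum_n (fun n => green b (Z.of_nat (a (S n)) - x)) N.

Lemma sum_n_rev (u : nat -> R) (n : nat) : sum_n (fun i => u (n - i)%nat) n = sum_n u n :> R.
Proof.
  induction n as [|n IH]; [now rewrite !sum_O|].
  rewrite sum_n_S_left, sum_n_S, Nat.sub_0_r.
  transitivity (u (S n) + sum_n (fun i => u (n - i)%nat) n); [|rewrite IH; ring].
  f_equal.
Qed.

Lemma sum_n_incr (u : nat -> R) (m n : nat) :
  (forall k, 0 <= u k) -> (m <= n)%nat -> sum_n u m <= sum_n u n.
Proof.
  intros Hu H; induction H as [|n H IH]; [lra|]. rewrite sum_n_S. specialize (Hu (S n)); lra.
Qed.

Lemma green_vanishes (b : R) (a : Z) : 0 < b < / 2 ->
  vanishes_at_infinity (fun x => green b (a - x)).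
Proof.
  intros Hb eps He. pose proof (green_lim b Hb) as Hl. apply is_lim_seq_spec in Hl.
  destruct (Hl (mkposreal eps He)) as [N HN]. exists (N + Z.abs_nat a)%nat. intros x Hx.
  specialize (HN N (le_n N)). simpl in HN.
  rewrite Rminus_0_r, Rabs_pos_eq in HN by (left; now apply green_pos).
  apply Rle_lt_trans with (2 := HN). apply green_decr; auto. lia.
Qed.

Lemma vanishes_at_infinity_plus (f g : Z -> R) :
  vanishes_at_infinity f -> vanishes_at_infinity g ->
  vanishes_at_infinity (fun x => f x + g x).
Proof.
  intros Hf Hg eps He.
  destruct (Hf (eps / 2) ltac:(lra)) as [L HL]. destruct (Hg (eps / 2) ltac:(lra)) as [M HM].
  exists (L + M)%nat. intros x Hx.
  specialize (HL x ltac:(lia)). specialize (HM x ltac:(lia)). lra.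
Qed.

Lemma green_sum_vanishes (b : R) (a : nat -> nat) (N : nat) : 0 < b < / 2 ->
  vanishes_at_infinity (green_sum b a N).
Proof.
  intros Hb; induction N as [|N IH].
  - intros eps He. destruct (green_vanishes b (Z.of_nat (a 1%nat)) Hb eps He) as [L HL].
    exists L. intros x Hx. unfold green_sum. rewrite sum_O. now apply HL.
  - intros eps He.
    destruct (vanishes_at_infinity_plus _ _ IH
      (green_vanishes b (Z.of_nat (a (S (S N)))) Hb) eps He) as [L HL].
    exists L. intros x Hx. unfold green_sum. rewrite sum_n_S. now apply HL.
Qed.

Lemma green_sum_harmonic (alpha : R) (a : nat -> nat) (N : nat) (x : Z) : 0 < alpha < 1 ->
  (forall n, (n <= N)%nat -> x <> Z.of_nat (a (S n))) ->
  is_sumZ (fun y => stable_kernel alpha (y - x) * green_sum (alpha / 2) a N y)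
    (green_sum (alpha / 2) a N x).
Proof.
  intros H. induction N as [|N IH]; intros Hx.
  - apply (is_sumZ_eq _ _ _ _ (green_equation alpha (Z.of_nat (a 1%nat)) x H));
      [intros y|]; unfold green_sum; rewrite sum_O; auto.
    rewrite srw_far; [ring|]. specialize (Hx 0%nat (le_n _)). lia.
  - apply (is_sumZ_eq _ _ _ _ (is_sumZ_plus _ _ _ _ (IH ltac:(auto))
      (green_equation alpha (Z.of_nat (a (S (S N)))) x H)));
      [intros y|]; unfold green_sum; rewrite sum_n_S.
    + ring.
    + rewrite srw_far; [ring|]. specialize (Hx (S N) (le_n _)). lia.
Qed.

Lemma index_le_of_increasing (a : nat -> nat) (n : nat) :
  (forall n, (1 <= n)%nat -> (0 < a n)%nat) ->
  (forall m n, (1 <= m)%nat -> (m < n)%nat -> (a m < a n)%nat) -> (n < a (S n))%nat.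
Proof.
  intros Hpos Hincr; induction n as [|n IH]; [apply Hpos; lia|].
  specialize (Hincr (S n) (S (S n)) ltac:(lia) ltac:(lia)). lia.
Qed.

(* By superlinearity [|a_n - a_k| >= a_|n-k|], so each half of the sum is at most the
   potential at [0]. *)
Lemma green_sum_upper (b : R) (a : nat -> nat) (k N : nat) : 0 < b < / 2 ->
  (forall m n, (0 < m)%nat -> (m < n)%nat -> (a (n - m)%nat + a m <= a n)%nat) ->
  (k <= N)%nat ->
  green_sum b a N (Z.of_nat (a (S k))) <= green b 0 + 2 * green_sum b a N 0.
Proof.
  intros Hb Hsup Hk.
  set (t := fun n => green b (Z.of_nat (a (S n)) - Z.of_nat (a (S k)))).
  set (c := fun n => green b (Z.of_nat (a (S n)) - 0)).
  assert (Hc : forall n, 0 <= c n) by (intros n; left; now apply green_pos).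
  assert (Hpre : sum_n t k <= green b 0 + sum_n c N).
  { assert (Htk : t k = green b 0) by (unfold t; now rewrite Z.sub_diag).
    destruct k as [|j].
    - rewrite sum_O, Htk. pose proof (sum_n_nonneg c N Hc). lra.
    - rewrite sum_n_S, Htk. rewrite Rplus_comm. apply Rplus_le_compat_l.
      apply Rle_trans with (sum_n c j); [|apply sum_n_incr; auto; lia].
      rewrite <- (sum_n_rev c). apply sum_n_le. intros n Hn. apply green_decr; auto.
      specialize (Hsup (S n) (S (S j)) ltac:(lia) ltac:(lia)).
      replace (S (S j) - S n)%nat with (S (j - n)) in Hsup by lia. lia. }
  assert (Hsuf : forall r, sum_n t (k + r) <= sum_n t k + (sum_n c r - c r)).
  { induction r as [|r IH].
    - rewrite Nat.add_0_r, sum_O. lra.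
    - rewrite Nat.add_succ_r, !sum_n_S.
      assert (Ht : t (S (k + r)) <= c r); [|lra].
      apply green_decr; auto.
      specialize (Hsup (S k) (S (S (k + r))) ltac:(lia) ltac:(lia)).
      replace (S (S (k + r)) - S k)%nat with (S r) in Hsup by lia. lia. }
  specialize (Hsuf (N - k)%nat). replace (k + (N - k))%nat with N in Hsuf by lia.
  assert (sum_n c (N - k) <= sum_n c N) by (apply sum_n_incr; auto; lia).
  pose proof (Hc (N - k)%nat). unfold green_sum. fold t c. lra.
Qed.

(** For n >= |x| the point a (S n) exceeds n, hence |x|, so its distance to x is at most 2 a (S n),
    and doubling the argument costs G only a constant factor. The terms of index at most |x| are
    given up, which is the subtracted sum. *)
Lemma green_sum_lower (b : R) (a : nat -> nat) : 0 < b < / 2 ->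
  (forall n, (1 <= n)%nat -> (0 < a n)%nat) ->
  (forall m n, (1 <= m)%nat -> (m < n)%nat -> (a m < a n)%nat) ->
  exists c, 0 < c /\ forall x N,
    c * green_sum b a N 0 - c * green_sum b a (Z.abs_nat x) 0 <= green_sum b a N x.
Proof.
  intros Hb Hpos Hincr. destruct (green_lower b Hb) as [c1 [Hc1 Hlow]].
  pose proof (green_pos b 0 Hb) as Hg0.
  (* This is the doubling constant: [c1] and [green b 0] are the lower and upper constants of the
     power bounds, and 2 bounds 2^(1-2b). *)
  exists (c1 / (2 * green b 0)).
  assert (Hc : 0 < c1 / (2 * green b 0)) by (apply Rdiv_lt_0_compat; lra).
  split; auto.
  assert (Hdouble : forall n, c1 / (2 * green b 0) * green b (Z.of_nat (S n))
    <= green b (2 * Z.of_nat (S n))).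
  { intros n. pose proof (green_upper b n Hb) as Hup.
    pose proof (Hlow (2 * n + 1)%nat) as Hlo.
    replace (Z.of_nat (S (2 * n + 1))) with (2 * Z.of_nat (S n))%Z in Hlo by lia.
    replace (INR (S (2 * n + 1))) with (2 * INR (S n)) in Hlo
      by (rewrite !S_INR, plus_INR, mult_INR; simpl; ring).
    pose proof (INR_S_pos n) as Hn.
    rewrite <- Rpower_mult_distr in Hlo by lra.
    assert (H2 : Rpower 2 (1 - 2 * b) <= 2).
    { pose proof (Rpower_bernoulli (1 - 2 * b) 1 ltac:(lra) ltac:(lra)) as HB.
      replace (1 + 1) with 2 in HB by ring. lra. }
    set (p := Rpower (INR (S n)) (1 - 2 * b)) in *.
    assert (Hp : 0 < p) by apply Rpower_pos.
    pose proof (green_pos b (2 * Z.of_nat (S n)) Hb) as Hg2.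
    set (g2 := green b (2 * Z.of_nat (S n))) in *.
    set (g1 := green b (Z.of_nat (S n))) in *.
    assert (Hlo2 : c1 <= g2 * (2 * p)).
    { apply Rle_trans with (1 := Hlo). apply Rmult_le_compat_l; [lra|].
      apply Rmult_le_compat_r; lra. }
    apply Rmult_le_reg_r with (2 * green b 0 * p); [nra|].
    replace (c1 / (2 * green b 0) * g1 * (2 * green b 0 * p)) with (c1 * (g1 * p))
      by (field; lra).
    apply Rle_trans with (c1 * green b 0); [apply Rmult_le_compat_l; lra|].
    replace (g2 * (2 * green b 0 * p)) with (g2 * (2 * p) * green b 0) by ring.
    apply Rmult_le_compat_r; lra. }
  set (c := c1 / (2 * green b 0)) in *.
  intros x N. unfold green_sum.
  set (s := fun n => green b (Z.of_nat (a (S n)) - 0)).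
  set (t := fun n => green b (Z.of_nat (a (S n)) - x)).
  assert (Hs : forall n, 0 <= s n) by (intros n; left; now apply green_pos).
  assert (Ht : forall n, 0 <= t n) by (intros n; left; now apply green_pos).
  assert (Hst : forall n, (Z.abs_nat x <= n)%nat -> c * s n <= t n).
  { intros n Hn. pose proof (index_le_of_increasing a n Hpos Hincr) as Han.
    unfold s, t. rewrite Z.sub_0_r.
    destruct (a (S n)) as [|m]; [lia|].
    apply Rle_trans with (1 := Hdouble m). apply green_decr; auto. lia. }
  induction N as [|N IH].
  - rewrite !sum_O. pose proof (term_le_sum_n s 0 (Z.abs_nat x) Hs ltac:(lia)).
    pose proof (Ht 0%nat). nra.
  - destruct (le_lt_dec (Z.abs_nat x) (S N)) as [Hx|Hx].
    + rewrite !sum_n_S. specialize (Hst (S N) Hx). lra.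
    + pose proof (sum_n_incr s (S N) (Z.abs_nat x) Hs ltac:(lia)).
      pose proof (sum_n_nonneg t (S N) Ht). nra.
Qed.

Lemma green_sum_unbounded_massive (alpha : R) (a : nat -> nat) : 0 < alpha < 1 ->
  (forall n, (1 <= n)%nat -> (0 < a n)%nat) ->
  (forall m n, (1 <= m)%nat -> (m < n)%nat -> (a m < a n)%nat) ->
  (forall n k, (0 < k)%nat -> (k < n)%nat -> (a (n - k)%nat + a k <= a n)%nat) ->
  (forall M, exists N, M < green_sum (alpha / 2) a N 0) ->
  massive alpha (fun z : Z => exists n : nat, (1 <= n)%nat /\ z = Z.of_nat (a n)).
Proof.
  intros H Hpos Hincr Hsup Hunb. set (b := alpha / 2) in *.
  assert (Hb : 0 < b < / 2) by (unfold b; lra).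
  set (B := fun z : Z => exists n : nat, (1 <= n)%nat /\ z = Z.of_nat (a n)).
  destruct (hitting_limit alpha B H) as [u (Hu & Hub & HuB & Hus)].
  destruct (green_sum_lower b a Hb Hpos Hincr) as [c [Hc Hlow]].
  apply (massive_of_uniform_hitting alpha B u (c / 6)); auto; [lra|].
  intros x; split; [|apply Hub].
  (* With S_N > 2 S_|x| + G(0), the lower bound c (S_N - S_|x|) is at least c S_N / 2, while M =
     G(0) + 2 S_N is at most 3 S_N. The quotient is at least c/6, whatever x is. *)
  destruct (Hunb (2 * green_sum b a (Z.abs_nat x) 0 + green b 0)) as [N HN].
  pose proof (green_pos b 0 Hb) as Hg0.
  assert (HS : forall m, 0 <= green_sum b a m 0).
  { intros m. apply (sum_n_nonneg (fun n => green b (Z.of_nat (a (S n)) - 0))).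
    intros n; left; now apply green_pos. }
  pose proof (HS N) as HSN. pose proof (HS (Z.abs_nat x)) as HSx.
  set (M := green b 0 + 2 * green_sum b a N 0).
  assert (HM : green_sum b a N x <= M * u x).
  { apply (maximum_principle alpha (fun z => exists n, (n <= N)%nat /\ z = Z.of_nat (a (S n))));
      auto.
    - unfold M; lra.
    - intros y; apply Hub.
    - now apply green_sum_vanishes.
    - intros y [n [Hn ->]]. rewrite HuB, Rmult_1_r.
      + apply green_sum_upper; auto.
      + exists (S n); split; [lia|auto].
    - intros y Hy. apply green_sum_harmonic; auto.
      intros n Hn E. apply Hy. now exists n. }
  specialize (Hlow x N). pose proof (Hub x) as Hux.
  apply Rmult_le_reg_l with M; [unfold M; lra|].
  apply Rle_trans with (2 := HM). apply Rle_trans with (2 := Hlow). unfold M. nra.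
Qed.

(** Moving x towards 0 one unit at a time costs one Harnack factor per step. Summability of the
    Green function over the points, seen from 0, thus extends to every starting point. *)
Lemma green_translate_le (b : R) (x z : Z) : 0 < b < / 2 ->
  green b (z - x) <= ((1 - b) / b) ^ Z.abs_nat x * green b z.
Proof.
  intros Hb.
  assert (HC : 0 < (1 - b) / b) by (apply Rdiv_lt_0_compat; lra).
  remember (Z.abs_nat x) as m eqn:Hm. revert x Hm.
  induction m as [|m IH]; intros x Hm.
  - replace x with 0%Z by lia. rewrite Z.sub_0_r. simpl; lra.
  - set (x' := (x - Z.sgn x)%Z).
    specialize (IH x' ltac:(unfold x'; lia)).
    rewrite <- tech_pow_Rmult, Rmult_assoc.
    apply Rle_trans with ((1 - b) / b * green b (z - x')).
    + apply green_harnack; auto. unfold x'. lia.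
    + apply Rmult_le_compat_l; lra.
Qed.

Lemma green_summable_not_massive (alpha : R) (a : nat -> nat) (l : R) : 0 < alpha < 1 ->
  is_series (fun n => green (alpha / 2) (Z.of_nat (a (S n)))) l ->
  ~ massive alpha (fun z : Z => exists n : nat, (1 <= n)%nat /\ z = Z.of_nat (a n)).
Proof.
  intros H Hl Hmass. set (b := alpha / 2) in *.
  assert (Hb : 0 < b < / 2) by (unfold b; lra).
  set (s := fun n => green b (Z.of_nat (a (S n)))) in *.
  assert (Hs : forall n, 0 <= s n) by (intros n; left; now apply green_pos).
  set (t := fun x n => green b (Z.of_nat (a (S n)) - x)).
  assert (Ht : forall x n, 0 <= t x n) by (intros x n; left; now apply green_pos).
  set (v := fun x => Series (t x)).
  assert (Hv : forall x, is_series (t x) (v x)).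
  { intros x. apply Series_correct.
    destruct (is_series_dominated (t x) (fun n => ((1 - b) / b) ^ Z.abs_nat x * s n)
      (((1 - b) / b) ^ Z.abs_nat x * l)) as [m [Hm _]].
    - intros n; split; [apply Ht|now apply green_translate_le].
    - now apply is_series_Rscal.
    - now exists m. }
  assert (Hsup : superharmonic alpha v).
  { intros x.
    (* [r n] is the one-step average at x of the n-th potential: it falls short of [t x n] by 1 when
       x is the pole, and by 0 otherwise. *)
    set (r := fun n => t x n - srw 0 (Z.of_nat (a (S n)) - x)).
    assert (Hr : forall n, is_sumZ (fun y => stable_kernel alpha (y - x) * t y n) (r n))
      by (intros n; apply green_equation; auto).
    destruct (is_series_dominated r (t x) (v x)) as [m [Hm Hmv]]; auto.
    - intros n; split.
      + apply (is_series_nonneg _ _) with (2 := Hr n). intros k; apply foldZ_nonneg.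
        intros y. apply Rmult_le_pos; [now apply kernel_nonneg|apply Ht].
      + unfold r. pose proof (srw_nonneg 0 (Z.of_nat (a (S n)) - x)). lra.
    - exists m; split; auto.
      apply (is_sumZ_tonelli (fun n y => stable_kernel alpha (y - x) * t y n) r); auto.
      + intros n y. apply Rmult_le_pos; [now apply kernel_nonneg|apply Ht].
      + intros y. now apply is_series_Rscal. }
  assert (Hhit : forall n x, hit_within alpha
    (fun z : Z => exists n : nat, (1 <= n)%nat /\ z = Z.of_nat (a n)) n x <= v x).
  { intros n x. apply hit_within_le_superharmonic; auto.
    - intros y. apply (is_series_nonneg (t y)); auto.
    - intros y [k [Hk ->]]. destruct k as [|k]; [lia|].
      apply Rle_trans with (t (Z.of_nat (a (S k))) k).
      + unfold t. rewrite Z.sub_diag. now apply green_0_ge_1.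
      + apply (term_le_is_series (t (Z.of_nat (a (S k))))); auto. }
  (* Dominated convergence by hand. Moving to the left of 0 increases the distance to all points, so
     the tail beyond N stays below 1/4, while far enough out each of the N+1 remaining terms is at
     most 1/(2(N+1)), adding up to at most 1/2. *)
  assert (Hsmall : exists x, v x <= 3 / 4).
  { assert (HN : exists N, l - sum_n s N < / 4).
    { pose proof (proj2 (is_lim_seq_spec (sum_n s) l) (proj1 (is_series_lim s l) Hl)) as Hlim.
      destruct (Hlim (mkposreal (/ 4) ltac:(lra))) as [N HN]. exists N.
      specialize (HN N (le_n N)). simpl in HN. apply Rabs_def2 in HN. lra. }
    destruct HN as [N HN].
    pose proof (green_lim b Hb) as Hg. apply is_lim_seq_spec in Hg.
    assert (He : 0 < / (2 * INR (S N)))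
      by (apply Rinv_0_lt_compat; pose proof (INR_S_pos N); lra).
    destruct (Hg (mkposreal _ He)) as [m Hm]. specialize (Hm m (le_n m)). simpl in Hm.
    change (match N with O => 1 | S _ => INR N + 1 end) with (INR (S N)) in Hm.
    rewrite Rminus_0_r, Rabs_pos_eq in Hm by (left; now apply green_pos).
    exists (- Z.of_nat m)%Z.
    assert (Hpre : sum_n (t (- Z.of_nat m)%Z) N <= / 2).
    { apply Rle_trans with (sum_n (fun _ => / (2 * INR (S N))) N).
      - apply sum_n_le. intros k _. left. apply Rle_lt_trans with (2 := Hm).
        apply green_decr; auto. lia.
      - rewrite sum_n_const. right. field. apply not_0_INR; lia. }
    assert (Hts : forall n, t (- Z.of_nat m)%Z n <= s n).
    { intros n. apply green_decr; auto. lia. }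
    assert (Hbound : forall r,
      sum_n (t (- Z.of_nat m)%Z) (N + r) <= / 2 + (sum_n s (N + r) - sum_n s N)).
    { induction r as [|r IH].
      - rewrite Nat.add_0_r. lra.
      - rewrite Nat.add_succ_r, !sum_n_S. specialize (Hts (S (N + r))). lra. }
    apply (is_lim_seq_le (sum_n (t (- Z.of_nat m)%Z)) (fun _ => 3 / 4)
      (v (- Z.of_nat m)%Z) (3 / 4)); [|apply Hv|apply is_lim_seq_const].
    intros n. apply Rle_trans with (sum_n (t (- Z.of_nat m)%Z) (N + n)).
    - apply sum_n_incr; [apply Ht|lia].
    - specialize (Hbound n). pose proof (sum_n_le_is_series s l (N + n) Hs Hl). lra. }
  destruct Hsmall as [x Hx].
  assert (Hcontra : 1 <= 3 / 4); [|lra].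
  apply (is_lim_seq_le (fun n => hit_within alpha
    (fun z : Z => exists n : nat, (1 <= n)%nat /\ z = Z.of_nat (a n)) n x)
    (fun _ => 3 / 4) 1 (3 / 4)); [|apply Hmass|apply is_lim_seq_const].
  intros n. apply Rle_trans with (1 := Hhit n x) (2 := Hx).
Qed.

Theorem theorem2p1 (alpha : R) (a : nat -> nat) :
  0 < alpha < 1 ->
  (forall n, (1 <= n)%nat -> (0 < a n)%nat) ->
  (forall m n, (1 <= m)%nat -> (m < n)%nat -> (a m < a n)%nat) ->
  (forall n k, (0 < k)%nat -> (k < n)%nat -> (a (n - k)%nat + a k <= a n)%nat) ->
  (massive alpha (fun z : Z => exists n : nat, (1 <= n)%nat /\ z = Z.of_nat (a n))
   <-> is_lim_seq (fun N => sum_n (fun n => / Rpower (INR (a (S n))) (1 - alpha)) N) p_infty).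
Proof.
  intros H Hpos Hincr Hsup.
  assert (Hb : 0 < alpha / 2 < / 2) by lra.
  set (w := fun n => / Rpower (INR (a (S n))) (1 - alpha)).
  set (g := fun n => green (alpha / 2) (Z.of_nat (a (S n)))).
  assert (Hw : forall n, 0 <= w n) by (intros n; left; apply Rinv_0_lt_compat, Rpower_pos).
  (* As 1 - 2b = 1 - alpha, the Green function along the sequence is comparable with [w]: this upper
     bound transfers convergence, and the lower bound [Hwg] transfers divergence. *)
  assert (Hgw : forall n, g n <= green (alpha / 2) 0 * w n).
  { intros n. unfold g, w. pose proof (Hpos (S n) ltac:(lia)) as Ha.
    destruct (a (S n)) as [|m]; [lia|].
    pose proof (green_upper (alpha / 2) m Hb) as Hup.
    replace (1 - 2 * (alpha / 2)) with (1 - alpha) in Hup by field.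
    pose proof (Rpower_pos (INR (S m)) (1 - alpha)) as Hp.
    apply Rmult_le_reg_r with (1 := Hp). rewrite Rmult_assoc, Rinv_l by lra. lra. }
  destruct (green_lower (alpha / 2) Hb) as [c [Hc Hlow]].
  assert (Hwg : forall n, c * w n <= g n).
  { intros n. unfold g, w. pose proof (Hpos (S n) ltac:(lia)) as Ha.
    destruct (a (S n)) as [|m]; [lia|]. specialize (Hlow m).
    replace (1 - 2 * (alpha / 2)) with (1 - alpha) in Hlow by field.
    pose proof (Rpower_pos (INR (S m)) (1 - alpha)) as Hp.
    apply Rmult_le_reg_r with (1 := Hp). rewrite Rmult_assoc, Rinv_l by lra. lra. }
  split.
  - intros Hmass. apply is_lim_seq_spec. intros M.
    (* The partial sums are nondecreasing, so if they are not eventually above M they never exceed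
       M, and the series converges. *)
    apply NNPP. intros Hn.
    destruct (is_series_bounded w M Hw) as [lw [Hlw _]].
    { intros n. apply Rnot_lt_le. intros Hlt. apply Hn. exists n. intros k Hk.
      apply Rlt_le_trans with (1 := Hlt). now apply sum_n_incr. }
    destruct (is_series_dominated g (fun n => green (alpha / 2) 0 * w n)
      (green (alpha / 2) 0 * lw)) as [lg [Hlg _]].
    + intros n; split; auto. left; now apply green_pos.
    + now apply is_series_Rscal.
    + now apply (green_summable_not_massive alpha a lg H).
  - intros Hdiv. apply green_sum_unbounded_massive; auto.
    intros M. apply is_lim_seq_spec in Hdiv.
    destruct (Hdiv (M / c)) as [N HN]. exists N. specialize (HN N (le_n N)).
    apply Rlt_le_trans with (c * sum_n w N).
    + apply Rmult_lt_reg_r with (/ c); [now apply Rinv_0_lt_compat|].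
      rewrite (Rmult_comm c), Rmult_assoc, Rinv_r, Rmult_1_r by lra.
      exact HN.
    + rewrite <- sum_n_Rscal. apply sum_n_le. intros k _.
      rewrite Z.sub_0_r. apply Hwg.
Qed.
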